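(* Let $(X(t):t\ge 0)$ be an irreducible non-explosive positive recurrent Markov jump process on a countable discrete state space $S$ with rate matrix $Q=(Q(x,y):x,y\in S)$, jump rates $\lambda(x)=-Q(x,x)\in(0,\infty)$, and embedded discrete-time chain $Y=(Y_n:n\ge0)$ with transition matrix $R(x,y)=Q(x,y)/\lambda(x)$ for $x\ne y$ and $R(x,x)=0$. Let $\eta$ be the non-negative non-trivial invariant measure of $Q$ ($\eta Q=0$, unique up to a multiplicative constant). Let $K\subseteq S$ be finite, let $z\in K$, and let $A\subseteq S$ be finite with $K\subseteq A$. Let $s:S\to\mathbb{R}_+$ with $\sum_x\eta(x)s(x)<\infty$, put $\delta=\sum_y\eta(y)s(y)\big/\sum_y\eta(y)$, $s_c(x)=s(x)-\delta$, $s'(x)=s(x)/\lambda(x)$ and $e'(x)=1/\lambda(x)$. Suppose that there exist functions $v_{s'},v_{e'}:S\to\mathbb{R}_+$ and constants $c_{s'},c_{e'}<\infty$ such that for all $x\in S$, $$(Rv_{s'})(x)\le v_{s'}(x)-s'(x)+c_{s'}I(x\in K),\qquad (Rv_{e'})(x)\le v_{e'}(x)-e'(x)+c_{e'}I(x\in K).$$ Let $G,\xi,\|\cdot\|_{\tilde K}$ and, for $q\in\{s',e'\}$, $\underline{\kappa}(x,q),\overline{\kappa}(x,q)$ ($x\in A$) be as defined in the context. If $\|(I-G)^{-1}\xi\|_{\tilde K}<1$, then the solution $h^*$ of Poisson's equation $Qh=-s_c$ given by $h^*(z)=0$ and $$h^*(x)=\mathbb{E}_x\sum_{j=0}^{\tau(z)-1}\frac{s(Y_j)}{\lambda(Y_j)}-\delta\,\mathbb{E}_x\sum_{j=0}^{\tau(z)-1}\frac{1}{\lambda(Y_j)},\qquad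 x\ne z,$$ satisfies, for every $x\in A-\{z\}$, $$\underline{\kappa}(x,s')-\frac{\overline{\kappa}(z,s')}{\underline{\kappa}(z,e')}\,\overline{\kappa}(x,e')\le h^*(x)\le \overline{\kappa}(x,s')-\frac{\underline{\kappa}(z,s')}{\overline{\kappa}(z,e')}\,\underline{\kappa}(x,e').$$
   Context: $\mathbb{P}_x,\mathbb{E}_x$ denote probability and expectation conditional on $Y_0=x$; functions are column vectors and measures row vectors; $\tau(z)=\inf\{n\ge 1:Y_n=z\}$. A solution of Poisson's equation with forcing function $s_c$ is a function $h:S\to\mathbb{R}$ with $\sum_y|Q(x,y)||h(y)|<\infty$ for each $x\in S$ and $Qh=-s_c$. Positive recurrence means in particular that $\eta$ has finite total mass (the embedded chain $Y$ is irreducible and recurrent, but possibly null recurrent). Put $A'=A-K$, $\tilde K=K-\{z\}$, $A^c=S-A$. Partition $R$ according to $(K,A',A^c)$ into blocks $R_{ij}$, $1\le i,j\le 3$ (so $R_{12}$ is the $K\times A'$ block, $R_{22}$ the $A'\times A'$ block, $R_{21}$ the $A'\times K$ block, $R_{13}$ the $K\times A^c$ block, $R_{23}$ the $A'\times A^c$ block). The inverse $(I-R_{22})^{-1}=\sum_{n\ge 0}R_{22}^n$ exists by irreducibility. For a function $\rho$ on $\tilde K$, $\|\rho\|_{\tilde K}=\max\{|\rho(x)|:x\in\tilde K\}$ (taken to be $0$ if $\tilde K=\emptyset$). - $G=(G(x,y):x,y\in\tilde K)$ with $G(x,y)=R(x,y)+(R_{12}(I-R_{22})^{-1}R_{21})(x,y)$;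 the inverse $(I-G)^{-1}=\sum_{n\ge0}G^n$ exists and is non-negative. - $\xi(x)=1-\sum_{y\in K}\big[R(x,y)+(R_{12}(I-R_{22})^{-1}R_{21})(x,y)\big]$ for $x\in\tilde K$, and $\xi(x)=1-\sum_{y\in K}((I-R_{22})^{-1}R_{21})(x,y)$ for $x\in A'$. In $(I-G)^{-1}\xi$, $\xi$ is the vector $(\xi(x):x\in\tilde K)$. For $q\in\{s',e'\}$ write $v=v_q$ for the corresponding Lyapunov function ($v_{s'}$ or $v_{e'}$), and let $q_1,q_2,q_3$ and $v_1,v_2,v_3$ be the restrictions of $q$ and $v$ to $K,A',A^c$. Define: - $k(x,q)=q_1(x)+(R_{12}(I-R_{22})^{-1}q_2)(x)$ for $x\in K$, and $k(x,q)=((I-R_{22})^{-1}q_2)(x)$ for $x\in A'$. - $\tilde k'(x,q)=(R_{13}v_3)(x)+(R_{12}(I-R_{22})^{-1}R_{23}v_3)(x)$ for $x\in K$, and $\tilde k'(x,q)=((I-R_{22})^{-1}R_{23}v_3)(x)$ for $x\in A'$. - $\beta(x,q)=k(x,q)+\tilde k'(x,q)$ for $x\in A$; $\beta(q)=(\beta(x,q):x\in\tilde K)$, $k(q)=(k(x,q):x\in\tilde K)$. - Lower quantities: $\underline{\kappa}(q)=(I-G)^{-1}k(q)$ on $\tilde K$, with entries $\underline{\kappa}(x,q)$; for $x\in A'$, $\underline{\kappa}(x,q)=k(x,q)+\sum_{y\in\tilde K}((I-R_{22})^{-1}R_{21})(x,y)\,\underline{\kappa}(y,q)$; and $\underline{\kappa}(z,q)=q(z)+\sum_{y\in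 A,\,y\ne z}R(z,y)\,\underline{\kappa}(y,q)$. - Upper quantities: on $\tilde K$, $\overline{\kappa}(q)=(I-G)^{-1}\beta(q)+(I-G)^{-1}\xi\;\dfrac{\|(I-G)^{-1}\beta(q)\|_{\tilde K}}{1-\|(I-G)^{-1}\xi\|_{\tilde K}}$, with entries $\overline{\kappa}(x,q)$; for $x\in A'$, $\overline{\kappa}(x,q)=\beta(x,q)+\sum_{y\in\tilde K}((I-R_{22})^{-1}R_{21})(x,y)\,\overline{\kappa}(y,q)+\xi(x)\,\|\overline{\kappa}(q)\|_{\tilde K}$; and $\overline{\kappa}(z,q)=q(z)+\sum_{y\in A,\,y\ne z}R(z,y)\,\overline{\kappa}(y,q)+\sum_{y\in A^c}R(z,y)\big(v_3(y)+\|\overline{\kappa}(q)\|_{\tilde K}\big)$. *)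

(* Defs.v *)
From HB Require Import structures.
From mathcomp Require Import all_boot all_order all_algebra finmap.
From mathcomp Require Import all_classical all_reals all_analysis.
Import Order.TTheory GRing.Theory Num.Theory.
Import numFieldNormedType.Exports.

Set Implicit Arguments.
Unset Strict Implicit.
Unset Printing Implicit Defensive.

Local Open Scope classical_set_scope.
Local Open Scope ring_scope.

(* The state space is a [countType]; vectors, measures and functions on it are
   maps [S -> R], matrices are maps [S -> S -> R]. *)

Section Sums.
Context {R : realType} {S : choiceType}.

(* [has_sum f a]: the unordered sum of the real family [f] converges
   absolutely, with value [a]. *)
Definition has_sum (f : S -> R) (a : R) : Prop :=
  summable setT (EFin \o f) /\
  fine (\esum_(x in setT) ((EFin \o f)^\+ x)%E)
  - fine (\esum_(x in setT) ((EFin \o f)^\- x)%E) = a.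

End Sums.

Section RateMatrix.
Context {R : realType} {S : countType}.
Implicit Types (Q : S -> S -> R) (f h eta : S -> R).

Definition jump_rate Q (x : S) : R := - Q x x.

(* Conservative rate matrix without absorbing states. *)
Definition rate_matrix Q : Prop :=
  [/\ forall x y, x != y -> 0 <= Q x y,
      forall x, 0 < jump_rate Q x
    & forall x, has_sum (Q x) 0].

Definition jump_matrix Q (x y : S) : R :=
  if x == y then 0 else Q x y / jump_rate Q x.

Definition invariant_measure Q eta : Prop :=
  [/\ forall x, 0 <= eta x,
      exists x, eta x != 0
    & forall y, has_sum (fun x => eta x * Q x y) 0].

(* Poisson's equation [Q h = - f]. *)
Definition poisson_solution Q f h : Prop :=
  forall x, has_sum (fun y => Q x y * h y) (- f x).

(* [M v <= v - q + c I(. \in K)], for non-negative [M] and [v]. *)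
Definition drift_inequality (M : S -> S -> R) (K : {fset S}) (q v : S -> R)
    (c : R) : Prop :=
  forall x, (\esum_(y in setT) (M x y * v y)%:E <=
             (v x - q x + c * (x \in K)%:R)%:E)%E.

Definition steady_mean eta f : R :=
  fine (\esum_(y in setT) (eta y * f y)%:E) / fine (\esum_(y in setT) (eta y)%:E).

End RateMatrix.

Section JumpProcess.
Context {R : realType} {S : countType} {d : measure_display}
        {Omega : measurableType d}.
Implicit Types (Q : S -> S -> R) (P : S -> probability Omega R)
         (Y : nat -> Omega -> S) (W : nat -> Omega -> R) (X : R -> Omega -> S)
         (w : Omega) (z : S).

(* [W n] is the holding time in the state [Y n], so that this is the epoch of
   the n-th jump (with epoch 0 equal to 0). *)
Definition jump_epoch W (n : nat) w : R := \sum_(i < n) W i w.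

(* Jump chain / holding time construction: under [P x], [Y] is a Markov chain
   started at [x] with transition matrix [jump_matrix Q] and, given [Y], the
   holding times [W n] are independent exponentials of rates
   [jump_rate Q (Y n)]. Nothing is assumed on [X] after an explosion. *)
Definition markov_jump_process Q P Y W X : Prop :=
  [/\ forall n x, measurable (Y n @^-1` [set x]),
      forall n, measurable_fun setT (W n),
      forall n w, 0 < W n w,
      forall (x : S) (n : nat) (y : nat -> S) (t : nat -> R),
        (forall i, 0 <= t i) ->
        P x [set w | forall i, (i <= n)%N -> Y i w = y i /\ t i < W i w] =
        ((y 0%N == x)%:R * (\prod_(i < n) jump_matrix Q (y i) (y i.+1))
         * \prod_(i < n.+1) expR (- (jump_rate Q (y i) * t i)))%:E
    & forall w n t, jump_epoch W n w <= t < jump_epoch W n.+1 w ->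
        X t w = Y n w].

Definition non_explosive P W : Prop :=
  forall x, {ae P x, forall w, (\sum_(n <oo) (W n w)%:E = +oo)%E}.

Definition irreducible P Y : Prop :=
  forall x y, exists n, (0 < P x (Y n @^-1` [set y]))%E.

(* First time after the first jump at which [X] is in [z]. *)
Definition return_time W X z w : \bar R :=
  ereal_inf [set t%:E | t in [set t | W 0%N w <= t /\ X t w = z]].

Definition positive_recurrent P W X : Prop :=
  forall z, {ae P z, forall w, (return_time W X z w < +oo)%E} /\
            (\int[P z]_w return_time W X z w < +oo)%E.

(* [tau(z) = inf {n >= 1 : Y_n = z}], equal to [+oo] if there is no such [n]. *)
Definition hitting_time Y z w : \bar R :=
  ereal_inf [set n%:R%:E | n in [set n | (1 <= n)%N /\ Y n w = z]].

(* [E_x sum_(0 <= j < tau(z)) f (Y_j)], for non-negative [f]. *)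
Definition cycle_mean P Y z (f : S -> R) (x : S) : \bar R :=
  (\int[P x]_w
     \sum_(0 <= j <oo | (j%:R%:E < hitting_time Y z w)%E) (f (Y j w))%:E)%E.

Definition poisson_hstar P Y z (s' e' : S -> R) (delta : R) (x : S) : R :=
  if x == z then 0
  else fine (cycle_mean P Y z s' x) - delta * fine (cycle_mean P Y z e' x).

End JumpProcess.

Section Blocks.
Context {R : realType} {S : countType}.
Implicit Types (B : {fset S}) (M N : S -> S -> R) (f : S -> R).

(* The matrix [(I - M_BB)^-1], extended by 0 outside of [B * B]. *)
Definition inv_block B M (x y : S) : R :=
  match (insub x : option B), (insub y : option B) with
  | Some u, Some v =>
      invmx (1%:M - \matrix_(i < #|{: B}|, j < #|{: B}|)
                      M (val (enum_val i)) (val (enum_val j)))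
        (enum_rank u) (enum_rank v)
  | _, _ => 0
  end.

(* Products of a matrix with a matrix or a column vector, the summation index
   ranging over [B]; blocks of a partitioned product are obtained by choosing
   [B]. *)
Definition mulm_on B M N (x y : S) : R := \sum_(a <- B) M x a * N a y.
Definition mulv_on B M f (x : S) : R := \sum_(a <- B) M x a * f a.

(* The same when the index ranges over the complement of [B], which may be
   infinite; for non-negative [M] and [f]. *)
Definition mulv_off B M f (x : S) : R :=
  fine (\esum_(a in ~` [set` B]) (M x a * f a)%:E).

Definition norm_on B f : R := \big[Num.max/0]_(x <- B) `|f x|.

End Blocks.

Section Bounds.
Context {R : realType} {S : countType}.
(* [J] is the jump matrix, written R in block notation: R_12 is the
   [K * A'] block, and so on. *)
Variables (J : S -> S -> R) (K A : {fset S}) (z : S).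

Definition Aprime : {fset S} := (A `\` K)%fset.
Definition Ktilde : {fset S} := (K `\ z)%fset.

(* (I - R_22)^-1 *)
Definition N22 : S -> S -> R := inv_block Aprime J.
(* (I - R_22)^-1 R_21 *)
Definition N22_R21 : S -> S -> R := mulm_on Aprime N22 J.
(* R_12 (I - R_22)^-1 R_21 *)
Definition R12_N22_R21 : S -> S -> R := mulm_on Aprime J N22_R21.

Definition Gmat (x y : S) : R := J x y + R12_N22_R21 x y.
(* (I - G)^-1, where G is indexed by [Ktilde] *)
Definition invG : S -> S -> R := inv_block Ktilde Gmat.

(* [xi], [kq], [ktq] and [betaq] are given by one formula on [K] and by another
   one on [A'], and are only used there. *)
Definition xi (x : S) : R :=
  if x \in K then 1 - \sum_(y <- K) (J x y + R12_N22_R21 x y)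
  else 1 - \sum_(y <- K) N22_R21 x y.

Definition invG_xi : S -> R := mulv_on Ktilde invG xi.

Variables (q v : S -> R).

Definition kq (x : S) : R :=
  if x \in K then q x + mulv_on Aprime J (mulv_on Aprime N22 q) x
  else mulv_on Aprime N22 q x.

Definition ktq (x : S) : R :=
  if x \in K then
    mulv_off A J v x
    + mulv_on Aprime J (mulv_on Aprime N22 (mulv_off A J v)) x
  else mulv_on Aprime N22 (mulv_off A J v) x.

Definition betaq (x : S) : R := kq x + ktq x.

(* The lower (and, below, the upper) quantities are built first on [Ktilde],
   then on [A - {z}], then on [A]: the value at [z] uses those on [A - {z}]. *)
Definition lower_Kt : S -> R := mulv_on Ktilde invG kq.

Definition lower_Az (x : S) : R :=
  if x \in K then lower_Kt x
  else kq x + mulv_on Ktilde N22_R21 lower_Kt x.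

Definition lower_kappa (x : S) : R :=
  if x == z then q z + mulv_on (A `\ z)%fset J lower_Az z else lower_Az x.

Definition invG_beta : S -> R := mulv_on Ktilde invG betaq.

Definition upper_Kt (x : S) : R :=
  invG_beta x
  + invG_xi x * (norm_on Ktilde invG_beta / (1 - norm_on Ktilde invG_xi)).

Definition upper_Az (x : S) : R :=
  if x \in K then upper_Kt x
  else betaq x + mulv_on Ktilde N22_R21 upper_Kt x
       + xi x * norm_on Ktilde upper_Kt.

Definition upper_kappa (x : S) : R :=
  if x == z then
    q z + mulv_on (A `\ z)%fset J upper_Az z
    + mulv_off A J (fun y => v y + norm_on Ktilde upper_Kt) z
  else upper_Az x.

End Bounds.

(* Main.v *)
Require Import Defs.
From HB Require Import structures.
From mathcomp Require Import all_boot all_order all_algebra finmap.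
From mathcomp Require Import all_classical all_reals all_analysis.
From mathcomp Require Import measurable_realfun ring lra.
Import Order.TTheory GRing.Theory Num.Theory.
Import numFieldNormedType.Exports.
Local Open Scope classical_set_scope.
Local Open Scope ring_scope.

Set Implicit Arguments.
Unset Strict Implicit.
Unset Printing Implicit Defensive.

(** Write [J] for the jump matrix, [T f (x) = sum_(y <> z) J(x, y) f(y)] for its
    action with [z] as a taboo state, and [u_q = sum_n T^n q]. Summing over paths
    shows that [u_q (x)] is the mean of [sum_(j < tau(z)) q(Y_j)] under [P x], so
    that [h* = u_s' - delta u_e'] off [z]; and [u_q] is the least non-negative
    solution of [q + T f <= f], with equality. Everything follows from this
    minimality and from the identity [u_q = q + T u_q].

    Finiteness. The potential of the indicator of a point is bounded, because
    irreducibility forces the chain to meet [z] within some number of steps with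
    positive probability ([green_ind_bounded]). Adding a multiple of the
    potential of [K] to the Lyapunov function gives a finite supersolution, so
    [u_q] is finite ([green_drift_finite]).

    Poisson's equation. Off [z] it is [u_q = q + T u_q]. At [z] it says that
    [delta = u_s' (z) / u_e' (z)]. Put [mu = eta lambda], a stationary measure
    of [J], and let [m] be the mean occupation measure of a cycle at [z]. Then
    [mu >= mu(z) m] always, and [m] is stationary since the chain returns to [z]
    almost surely, a return of [X] being one of [Y] when there is no explosion.
    The stationary measure [mu - mu(z) m] vanishes at [z], hence everywhere by
    irreducibility ([stationary_integral]).

    Bounds. On [A - {z}] the potential satisfies [u >= q + J u] with the sum
    restricted to [A - {z}]; eliminating [A'] gives [u >= k + G u] on [K - {z}],
    whence the lower bounds. For the upper ones, minimality yields
    [u <= v + max_(K - {z}) u] off [K] ([potential_le_off]); inserted in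
    [u = q + T u], and after the same elimination, this reads
    [u <= (I - G)^-1 beta + (I - G)^-1 xi max_(K - {z}) u] on [K - {z}], and
    [||(I - G)^-1 xi|| < 1] allows to solve for the maximum. Both eliminations
    rest on the minimum principle for a non-negative matrix with a strict
    supersolution ([supersolution_ge0]), which also shows that the two inverses
    exist and are non-negative; the strict supersolution is the mean number of
    visits to [A - {z}] before [tau(z)]. The bounds on [h*] combine those at [x]
    with those on [delta] that come from [x = z]. *)

(** * Unordered sums *)

Section Esum.
Local Open Scope ereal_scope.
Context {R : realType}.

Lemma esum_ge_term (T : choiceType) (I : set T) (a : T -> \bar R) (x : T) :
  (forall y, I y -> 0 <= a y) -> I x -> a x <= \esum_(y in I) a y.
Proof.
move=> a0 Ix; rewrite (esumID [set x])//.
have -> : I `&` [set x] = [set x].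
  by apply/seteqP; split=> [y [//]|y ->].
rewrite esum_set1 ?a0// leeDl//.
by apply: esum_ge0 => y [/a0].
Qed.

Lemma esum_eq0P (T : choiceType) (I : set T) (a : T -> \bar R) :
  (forall y, I y -> 0 <= a y) -> \esum_(y in I) a y = 0 ->
  forall x, I x -> a x = 0.
Proof.
move=> a0 s0 x Ix; apply/eqP; rewrite eq_le a0// andbT -s0.
exact: esum_ge_term.
Qed.

Lemma esumZ (T : choiceType) (I : set T) (c : R) (a : T -> \bar R) :
  (0 <= c)%R -> (forall y, I y -> 0 <= a y) ->
  \esum_(y in I) (c%:E * a y) = c%:E * \esum_(y in I) a y.
Proof.
move=> c0 a0; have fsumZ X : fsets I X ->
    \sum_(y \in X) (c%:E * a y) = c%:E * \sum_(y \in X) a y.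
  move=> [fX XI]; rewrite !fsbig_finite//= big_seq [in RHS]big_seq ge0_sume_distrr//.
  by move=> y; rewrite in_fset_set// inE => /XI/a0.
move: c0; rewrite le_eqVlt => /predU1P[<-|c0].
  by rewrite mul0e esum1// => y _; rewrite mul0e.
apply/eqP; rewrite eq_le; apply/andP; split.
  apply: ge_ereal_sup => _ [X IX <-]; rewrite fsumZ// lee_pmul2l// .
  by apply: ereal_sup_ubound; exists X.
rewrite -lee_pdivlMl//; apply: ge_ereal_sup => _ [X IX <-].
rewrite lee_pdivlMl// -fsumZ//.
by apply: ereal_sup_ubound; exists X.
Qed.

Lemma esum_exchange (T1 T2 : choiceType) (I : set T1) (J : set T2)
    (a : T1 -> T2 -> \bar R) :
  (forall i j, 0 <= a i j) ->
  \esum_(i in I) \esum_(j in J) a i j = \esum_(j in J) \esum_(i in I) a i j.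
Proof.
move=> a0; rewrite !esum_esum//.
rewrite (reindex_esum (I `*`` (fun=> J)) (J `*`` (fun=> I))
  (fun x => (x.2, x.1)))//; split=> //=.
- by move=> [i j] [].
- by move=> [i1 i2] [j1 j2] /= _ _ [] -> ->.
- by move=> [i1 i2] [Pi1 Qi2] /=; exists (i2, i1).
Qed.

Lemma esum_seq_fset (T : choiceType) (B : {fset T}) (f : T -> R) :
  (forall x, x \in B -> (0 <= f x)%R) ->
  \esum_(y in [set` B]) (f y)%:E = (\sum_(y <- B) f y)%R%:E.
Proof.
move=> f0; rewrite esum_fset//; last first.
  by move=> i; rewrite inE /= => /f0; rewrite lee_fin.
by rewrite fsbig_finite//= set_fsetK sumEFin.
Qed.

Lemma esum_nneseries (T : countType) (a : T -> \bar R) :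
  (forall y, 0 <= a y) ->
  \esum_(y in setT) a y = \sum_(n <oo) oapp a 0 (pickle_inv n).
Proof.
move=> a0.
have b0 n : 0 <= oapp a 0 (pickle_inv n) by case: pickle_inv => /=.
rewrite nneseries_esumT//.
rewrite (esumID (range (@choice.pickle T)))// setTI [X in _ + X]esum1; last first.
  move=> n [_ /= nr]; case: (@pickle_inv T n) (@pickle_invK T n) => //= y yn.
  by case: nr; exists y.
rewrite adde0 esum_image; last by apply: in2W; exact: (pcan_inj (@choice.pickleK T)).
by apply: eq_esum => y _; rewrite pickleK_inv.
Qed.

End Esum.

Section HasSum.
Context {R : realType} {T : choiceType}.

(** A family that is a difference of non-negative families with finite sums is
    absolutely summable, and its sum is the difference of the sums. *)
Lemma has_sumB (f g h : T -> R) (a b : R) :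
  (forall x, f x = g x - h x) ->
  (forall x, 0 <= g x) -> (forall x, 0 <= h x) ->
  (\esum_(x in setT) (g x)%:E = a%:E)%E ->
  (\esum_(x in setT) (h x)%:E = b%:E)%E -> has_sum f (a - b).
Proof.
move=> fE g0 h0 ga hb.
have sg : summable setT (EFin \o g).
  rewrite /summable (eq_esum (b := EFin \o g)) ?ga ?ltry//.
  by move=> x _; rewrite /= ger0_norm.
have sh : summable setT (EFin \o h).
  rewrite /summable (eq_esum (b := EFin \o h)) ?hb ?ltry//.
  by move=> x _; rewrite /= ger0_norm.
have EF : EFin \o f = ((EFin \o g) \- (EFin \o h))%E.
  by apply/funext => x /=; rewrite fE EFinB.
have sf : summable setT (EFin \o f) by rewrite EF; exact: summableB.
split=> //.
have := @esumB _ _ _ _ _ sg sh (fun x _ => g0 x) (fun x _ => h0 x).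
rewrite -EF => H.
have /(congr1 fine) := H; rewrite ga hb /= => <-.
rewrite fineB//.
- have := summable_funepos sf; rewrite summableE; congr (_ \is a fin_num).
  by apply: eq_esum => x _; rewrite gee0_abs.
- have := summable_funeneg sf; rewrite summableE; congr (_ \is a fin_num).
  by apply: eq_esum => x _; rewrite gee0_abs.
Qed.

(** Conversely, the first of two such families has a finite sum if the second
    one has. *)
Lemma has_sum_esum (f g h : T -> R) (a b : R) :
  has_sum f a -> (forall x, f x = g x - h x) ->
  (forall x, 0 <= g x) -> (forall x, 0 <= h x) ->
  (\esum_(x in setT) (h x)%:E = b%:E)%E ->
  (\esum_(x in setT) (g x)%:E = (a + b)%:E)%E.
Proof.
move=> hs fE g0 h0 hb.
have sh : summable setT (EFin \o h).
  rewrite /summable (eq_esum (b := EFin \o h)) ?hb ?ltry//.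
  by move=> x _; rewrite /= ger0_norm.
have EF : EFin \o g = ((EFin \o f) \+ (EFin \o h))%E.
  by apply/funext => x /=; rewrite fE -EFinD subrK.
have : summable setT (EFin \o g) by rewrite EF; apply: summableD => //; case: hs.
rewrite summableE (eq_esum (b := EFin \o g)) => [gfin|x _]; last first.
  by rewrite /= ger0_norm.
have gE : (\esum_(x in setT) (EFin \o g) x =
           (fine (\esum_(x in setT) (EFin \o g) x))%:E)%E by rewrite fineK.
have [_ <-] := hs; have [_ ->] := has_sumB fE g0 h0 gE hb.
by rewrite subrK -gE.
Qed.

End HasSum.

(** * Non-negative matrices acting on functions *)

(** The action [J_B f (x) = sum_(y in B) J(x, y) f(y)] of the columns in [B] of
    a non-negative matrix [J] on a function with values in [[0, +oo]]. *)
Definition act {R : realType} {S : choiceType} (J : S -> S -> R) (B : set S)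
    (f : S -> \bar R) (x : S) : \bar R :=
  (\esum_(y in B) ((J x y)%:E * f y))%E.

(** The potential [sum_(n >= 0) J_B^n q]. *)
Definition green {R : realType} {S : choiceType} (J : S -> S -> R) (B : set S)
    (q : S -> \bar R) (x : S) : \bar R :=
  (\esum_(n in [set: nat]) iter n (act J B) q x)%E.

(** The indicator function of [{y}]. *)
Definition ind {R : realType} {S : choiceType} (y x : S) : \bar R :=
  ((x == y)%:R)%:E.

Section Operator.
Local Open Scope ereal_scope.
Context {R : realType} {S : choiceType} (J : S -> S -> R) (B : set S).
Context (J0 : forall x y, (0 <= J x y)%R).
Implicit Types (f g : S -> \bar R).
Local Notation T := (act J B).

Lemma ind_ge0 (y x : S) : 0 <= ind y x :> \bar R.
Proof. by rewrite lee_fin ler0n. Qed.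

Lemma act_ge0 f x : (forall y, 0 <= f y) -> 0 <= T f x.
Proof. by move=> f0; apply: esum_ge0 => y _; rewrite mule_ge0// lee_fin. Qed.

Lemma le_act f g x : (forall y, B y -> f y <= g y) -> T f x <= T g x.
Proof.
by move=> fg; apply: le_esum => y /fg; apply: lee_wpmul2l; rewrite lee_fin.
Qed.

Lemma eq_act f g x : (forall y, B y -> f y = g y) -> T f x = T g x.
Proof. by move=> fg; apply: eq_esum => y /fg ->. Qed.

Lemma actD f g x : (forall y, 0 <= f y) -> (forall y, 0 <= g y) ->
  T (fun y => f y + g y) x = T f x + T g x.
Proof.
move=> f0 g0; rewrite /act -esumD.
- by apply: eq_esum => y _; rewrite ge0_muleDr.
- by move=> y _; rewrite mule_ge0// lee_fin.
- by move=> y _; rewrite mule_ge0// lee_fin.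
Qed.

Lemma actZ (c : R) f x : (0 <= c)%R -> (forall y, 0 <= f y) ->
  T (fun y => c%:E * f y) x = c%:E * T f x.
Proof.
move=> c0 f0; rewrite /act -esumZ//.
  by apply: eq_esum => y _; rewrite muleCA.
by move=> y _; rewrite mule_ge0// lee_fin.
Qed.

Lemma act_esum (I : choiceType) (D : set I) (a : I -> S -> \bar R) x :
  (forall i y, 0 <= a i y) ->
  T (fun y => \esum_(i in D) a i y) x = \esum_(i in D) T (a i) x.
Proof.
move=> a0; rewrite /act esum_exchange; last first.
  by move=> i y; rewrite mule_ge0// lee_fin.
by apply: eq_esum => y _; rewrite esumZ.
Qed.

Lemma iter_act_ge0 n f : (forall y, 0 <= f y) -> forall x, 0 <= iter n T f x.
Proof. by move=> f0; elim: n => //= n IH x; apply: act_ge0. Qed.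

Lemma le_iter_act n f g : (forall y, f y <= g y) ->
  forall x, iter n T f x <= iter n T g x.
Proof. by move=> fg; elim: n => //= n IH x; apply: le_act. Qed.

Lemma iter_actD n f g : (forall y, 0 <= f y) -> (forall y, 0 <= g y) ->
  forall x, iter n T (fun y => f y + g y) x = iter n T f x + iter n T g x.
Proof.
move=> f0 g0; elim: n => //= n IH x; rewrite (eq_act _ (fun y _ => IH y)).
by rewrite actD// => y; exact: iter_act_ge0.
Qed.

Lemma iter_actZ n (c : R) f : (0 <= c)%R -> (forall y, 0 <= f y) ->
  forall x, iter n T (fun y => c%:E * f y) x = c%:E * iter n T f x.
Proof.
move=> c0 f0; elim: n => //= n IH x; rewrite (eq_act _ (fun y _ => IH y)).
by rewrite actZ// => y; exact: iter_act_ge0.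
Qed.

Lemma iter_act_esum n (I : choiceType) (D : set I) (a : I -> S -> \bar R) :
  (forall i y, 0 <= a i y) -> forall x,
  iter n T (fun y => \esum_(i in D) a i y) x = \esum_(i in D) iter n T (a i) x.
Proof.
move=> a0; elim: n => //= n IH x; rewrite (eq_act _ (fun y _ => IH y)).
by rewrite act_esum// => i y; exact: iter_act_ge0.
Qed.

Lemma esum_ind (q : S -> R) x : (forall y, (0 <= q y)%R) ->
  (q x)%:E = \esum_(y in setT) ((q y)%:E * ind y x).
Proof.
move=> q0; rewrite (esumID [set x]); last first.
  by move=> y _; rewrite mule_ge0 ?ind_ge0// lee_fin.
rewrite setTI esum_set1; last by rewrite mule_ge0 ?ind_ge0// lee_fin.
rewrite /ind eqxx mule1 esum1 ?adde0// => y [_ /= /eqP/negPf].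
by rewrite eq_sym => ->; rewrite mule0.
Qed.

(** By linearity, the powers of [J_B] are determined by their columns
    [J_B^n 1_{y}]. *)
Lemma iter_act_ind n (q : S -> R) x : (forall y, (0 <= q y)%R) ->
  iter n T (fun y => (q y)%:E) x =
  \esum_(y in setT) ((q y)%:E * iter n T (ind y) x).
Proof.
move=> q0.
have -> : (fun y => (q y)%:E) = (fun x => \esum_(y in setT) ((q y)%:E * ind y x)).
  by apply/funext => w; exact: esum_ind.
rewrite iter_act_esum; last by move=> y w; rewrite mule_ge0 ?ind_ge0// lee_fin.
by apply: eq_esum => y _; rewrite iter_actZ// => w; exact: ind_ge0.
Qed.

Lemma esum_natS (a : nat -> \bar R) : (forall n, 0 <= a n) ->
  \esum_(n in setT) a n = a 0%N + \esum_(n in setT) a n.+1.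
Proof.
move=> a0; rewrite (esumID [set 0%N])// setTI esum_set1//; congr (_ + _).
rewrite -(esum_image setT succn a); last by apply: in2W => m n [].
congr (esum _ _); apply/seteqP; split=> [[|n] [_ /=]//|n [m _ <-]//].
by move=> _; exists n.
Qed.

Lemma green_ge0 f x : (forall y, 0 <= f y) -> 0 <= green J B f x.
Proof. by move=> f0; apply: esum_ge0 => n _; exact: iter_act_ge0. Qed.

Lemma green_fix q x : (forall y, 0 <= q y) ->
  green J B q x = q x + T (green J B q) x.
Proof.
move=> q0; rewrite /green esum_natS => [|n]; last exact: iter_act_ge0.
by congr (_ + _); rewrite act_esum// => n y; exact: iter_act_ge0.
Qed.

Lemma le_esum_nat (a : nat -> \bar R) (M : \bar R) : (forall n, 0 <= a n) ->
  (forall n, \sum_(k < n) a k <= M) -> \esum_(n in setT) a n <= M.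
Proof.
move=> a0 aM; rewrite -nneseries_esumT//; apply: lime_le.
  exact: is_cvg_nneseries_cond.
by apply: nearW => n; rewrite big_mkord.
Qed.

Lemma iter_act_sumS n q x : (forall y, 0 <= q y) ->
  \sum_(k < n.+1) iter k T q x = q x + T (fun y => \sum_(k < n) iter k T q y) x.
Proof.
move=> q0; rewrite big_ord_recl; congr (_ + _).
rewrite /act; under [RHS]eq_esum do
  (rewrite ge0_sume_distrr; last by move=> k _; exact: iter_act_ge0).
rewrite esum_sum// => y k _ _; rewrite mule_ge0 ?lee_fin//.
exact: iter_act_ge0.
Qed.

(** The potential of [q] is the least non-negative solution of [q + J_B f <= f]. *)
Lemma green_min q f : (forall y, 0 <= q y) -> (forall y, 0 <= f y) ->
  (forall y, q y + T f y <= f y) -> forall x, green J B q x <= f x.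
Proof.
move=> q0 f0 qf x; apply: le_esum_nat => [n|n]; first exact: iter_act_ge0.
elim: n x => [|n IH] x; first by rewrite big_ord0.
by rewrite iter_act_sumS//; apply: le_trans (qf x); rewrite leeD2l// le_act.
Qed.

End Operator.

(** * Path probabilities of a discrete chain *)

Section Chain.
Local Open Scope ereal_scope.
Context {R : realType} {S : countType} {d : measure_display}
  {Omega : measurableType d} (P : S -> probability Omega R)
  (Y : nat -> Omega -> S) (J : S -> S -> R).
(* [pY] is the law of the chain: the cylinder probabilities under [P x]. *)
Context (J0 : forall x y, (0 <= J x y)%R)
  (mY : forall n x, measurable (Y n @^-1` [set x]))
  (pY : forall x n (y : nat -> S),
     P x [set w | forall i, (i <= n)%N -> Y i w = y i] =
     ((y 0%N == x)%:R * \prod_(i < n) J (y i) (y i.+1))%:E).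

Lemma measurable_state n (C : set S) : measurable (Y n @^-1` C).
Proof.
have -> : Y n @^-1` C = \bigcup_a (if a \in C then Y n @^-1` [set a] else set0).
  apply/seteqP; split => w /=.
    by move=> Cw; exists (Y n w) => //; rewrite mem_set.
  by move=> [a _]; case: ifPn => //; rewrite inE => Ca /= ->.
apply: countable_bigcupT_measurable => // a.
by case: ifP.
Qed.

(** Decomposition of an event along the state of the chain at time [n]. *)
Lemma measure_state (x : S) n (E : set Omega) : measurable E ->
  P x E = \esum_(a in setT) P x (E `&` Y n @^-1` [set a]).
Proof.
move=> mE; rewrite esum_nneseries//.
pose F k := oapp (fun a => E `&` Y n @^-1` [set a]) set0 (pickle_inv k).
have mF k : measurable (F k).
  by rewrite /F; case: pickle_inv => //= a; apply: measurableI => //.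
have EF : E = \bigcup_k F k.
  apply/seteqP; split => [w Ew|w [k _]]; rewrite /F.
    by exists (choice.pickle (Y n w)) => //; rewrite pickleK_inv.
  by case: pickle_inv => //= a [].
rewrite [in LHS]EF measure_semi_bigcup//; last by rewrite -EF.
  by apply: eq_eseriesr => k _; rewrite /F; case: pickle_inv => //=.
move=> i j _ _ [w []]; rewrite /F.
have := @pickle_invK S i; have := @pickle_invK S j.
case: (pickle_inv i) => //= a; case: (pickle_inv j) => //= b <- <-.
by move=> [_ ->] [_ ->].
Qed.

(** The paths that start with [y 0, ..., y k], stay in [B] for the next [r]
    steps, and are in [D] at time [k + r]. *)
Definition path_event (y : nat -> S) (k : nat) (B : set S) (r : nat)
    (D : set S) : set Omega :=
  [set w | [/\ forall i, (i <= k)%N -> Y i w = y i,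
               forall i, (k < i <= k + r)%N -> B (Y i w)
             & D (Y (k + r)%N w)]].

Lemma measurable_path_event y k B r D : measurable (path_event y k B r D).
Proof.
have -> : path_event y k B r D =
    (\bigcap_(i in `I_k.+1) (Y i @^-1` [set y i]))
    `&` (\bigcap_(i in [set: nat])
          (if (k < i <= k + r)%N then Y i @^-1` B else setT))
    `&` Y (k + r)%N @^-1` D.
  apply/seteqP; split => w /=.
    move=> [h1 h2 h3]; split=> //; split=> [i ik|i _]; first exact: (h1 i ik).
    by case: ifP => // /h2.
  move=> [[h1 h2] h3]; split=> // i ik.
  by have := h2 i I; rewrite ik.
apply: measurableI; last exact: measurable_state.
apply: measurableI; apply: bigcap_measurable => //.
- by exists 0%N.
- by move=> i _; case: ifP => // _; exact: measurable_state.
Qed.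

(** The taboo powers of [J] are path probabilities. The induction conditions on
    the state at time [k + 1]. *)
Lemma path_law r (x : S) (y : nat -> S) k (B D : set S) :
  P x (path_event y k B r D) =
  ((y 0%N == x)%:R * \prod_(i < k) J (y i) (y i.+1))%:E *
  iter r (act J B) (fun a => (a \in D)%:R%:E) (y k).
Proof.
elim: r y k => [|r IH] y k /=.
  have [yD|yD] := boolP (y k \in D).
    rewrite mule1 -pY; congr (P x _); apply/seteqP; split => w /=; first by case.
    move=> h; split=> //.
      by move=> i; rewrite addn0 ltnNge; case: leqP.
    by rewrite addn0 h//; exact: set_mem.
  rewrite mule0 [X in P x X](_ : _ = set0) ?measure0//.
  apply/seteqP; split => // w [h _]; rewrite addn0 h// => /mem_set.
  by rewrite (negPf yD).
rewrite (measure_state x k.+1); last exact: measurable_path_event.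
rewrite (esumID B)// !setTI [X in _ + X]esum1 ?adde0; last first.
  move=> a nBa; rewrite [X in P x X](_ : _ = set0) ?measure0//.
  apply/seteqP; split => // w [[_ h _] /= wa]; apply: nBa; rewrite -wa.
  by apply: h; rewrite leqnn/= addnS ltnS leq_addr.
have c0 : (0 <= (y 0%N == x)%:R * \prod_(i < k) J (y i) (y i.+1))%R.
  by rewrite mulr_ge0// prodr_ge0.
rewrite /act -esumZ//; last first.
  move=> a _; rewrite mule_ge0 ?lee_fin//; exact: iter_act_ge0.
apply: eq_esum => a Ba.
pose y' i := if (i <= k)%N then y i else a.
have -> : path_event y k B r.+1 D `&` Y k.+1 @^-1` [set a] =
          path_event y' k.+1 B r D.
  apply/seteqP; split => w.
    move=> [[h1 h2 h3] /= wa]; split.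
    - move=> i; rewrite /y' leq_eqVlt ltnS => /predU1P[->|ik].
        by rewrite ltnn.
      by rewrite ik h1.
    - move=> i /andP[ki ikr]; apply: h2.
      by rewrite (ltn_trans _ ki)//= addnS.
    - by rewrite addSn -addnS.
  move=> [h1 h2 h3]; have wa : Y k.+1 w = a by rewrite h1// /y' ltnn.
  split=> //; split.
  - by move=> i ik; rewrite h1 /y' ?ik// ltnW.
  - move=> i /andP[]; rewrite leq_eqVlt => /predU1P[<- _|ki ikr].
      by rewrite wa.
    by apply: h2; rewrite ki addSn -addnS.
  - by rewrite addnS -addSn.
have y'S : y' k.+1 = a by rewrite /y' ltnn.
have y'k : y' k = y k by rewrite /y' leqnn.
have prodE : (\prod_(i < k.+1) J (y' i) (y' i.+1) =
    \prod_(i < k) J (y i) (y i.+1) * J (y k) a)%R.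
  rewrite big_ord_recr/= y'S y'k; congr (_ * _)%R; apply: eq_bigr => i _.
  by rewrite /y' ltn_ord (ltnW (ltn_ord i)).
by rewrite IH prodE y'S mulrA EFinM muleA.
Qed.

Lemma measurable_path0 r (B D : set S) : measurable
  [set w | (forall i, (0 < i <= r)%N -> B (Y i w)) /\ D (Y r w)].
Proof.
have -> : [set w | (forall i, (0 < i <= r)%N -> B (Y i w)) /\ D (Y r w)] =
    (\bigcap_(i in [set: nat])
       (if (0 < i <= r)%N then Y i @^-1` B else setT)) `&` Y r @^-1` D.
  apply/seteqP; split => w /=.
    by move=> [h2 h3]; split=> // i _; case: ifP => // /h2.
  move=> [h2 h3]; split=> // i.
  by move=> ik; have := h2 i I; rewrite ik.
apply: measurableI; last exact: measurable_state.
apply: bigcap_measurable => //.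
by move=> i _; case: ifP => // _; exact: measurable_state.
Qed.

Lemma path_law0 r (x : S) (B D : set S) :
  P x [set w | (forall i, (0 < i <= r)%N -> B (Y i w)) /\ D (Y r w)] =
  iter r (act J B) (fun a => (a \in D)%:R%:E) x.
Proof.
pose E := [set w | (forall i, (0 < i <= r)%N -> B (Y i w)) /\ D (Y r w)].
have mE : measurable E by exact: measurable_path0.
have EE a : E `&` Y 0%N @^-1` [set a] = path_event (fun=> a) 0 B r D.
  apply/seteqP; split => w.
    move=> [[h2 h3] /= wa]; split => // i.
    by rewrite leqn0 => /eqP ->.
  by move=> [h1 h2 h3]; split; [split|exact: h1].
rewrite -/E (measure_state x 0 mE) (esumID [set x])// setTI esum_set1//.
rewrite [X in _ + X]esum1; last first.
  by move=> a [_ /= /eqP/negPf ax]; rewrite EE path_law ax !mul0r mul0e.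
by rewrite adde0 EE path_law eqxx big_ord0 mulr1 mul1e.
Qed.

End Chain.

(** * Irreducible stochastic matrices with a taboo state *)

Section Taboo.
Local Open Scope ereal_scope.
Context {R : realType} {S : countType} (J : S -> S -> R) (z : S).
Context (J0 : forall x y, (0 <= J x y)%R)
  (J1 : forall x, \esum_(y in setT) (J x y)%:E = 1)
  (Jirr : forall x y, exists n, 0 < iter n (act J setT) (ind y) x).
(* Transitions that do not enter [z]. *)
Local Notation T := (act J (~` [set z])).

Lemma actT_split f x : (forall y, 0 <= f y) ->
  act J setT f x = (J x z)%:E * f z + T f x.
Proof.
move=> f0; rewrite /act (esumID [set z]); last first.
  by move=> y _; rewrite mule_ge0// lee_fin.
by rewrite !setTI esum_set1// mule_ge0// lee_fin.
Qed.

Lemma act_le_actT f x : (forall y, 0 <= f y) -> T f x <= act J setT f x.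
Proof.
by move=> f0; rewrite actT_split// leeDr// mule_ge0// lee_fin.
Qed.

Lemma actT_cst (c : R) x : (0 <= c)%R -> act J setT (cst c%:E) x = c%:E.
Proof.
move=> c0; rewrite /act (eq_esum (b := fun y => c%:E * (J x y)%:E)).
  by rewrite esumZ ?J1 ?mule1// => y _; rewrite lee_fin.
by move=> y _; rewrite muleC.
Qed.

Lemma act_cst_le (c : R) x : (0 <= c)%R -> T (cst c%:E) x <= c%:E.
Proof.
by move=> c0; rewrite -[leRHS](actT_cst x c0) act_le_actT.
Qed.

Lemma iter_act_le1 n f : (forall y, f y <= 1) -> forall x, iter n T f x <= 1.
Proof.
move=> f1; elim: n => //= n IH x.
by apply: le_trans (act_cst_le x ler01); apply: le_act.
Qed.

Lemma iter_actT_le1 n f : (forall y, f y <= 1) ->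
  forall x, iter n (act J setT) f x <= 1.
Proof.
move=> f1; elim: n => //= n IH x.
by rewrite -[leRHS](actT_cst x ler01); apply: le_act.
Qed.

Lemma ind_le1 (y x : S) : ind y x <= 1 :> \bar R.
Proof. by rewrite /ind lee_fin; case: eqP. Qed.

(** For a start off [z], being at [z] at time [n] and not having visited [z] up to
    time [n] are exclusive events. *)
Lemma hit_or_avoid n x : x != z ->
  iter n (act J setT) (ind z) x + iter n T (cst 1) x <= 1.
Proof.
elim: n x => [|n IH] x xz /=; first by rewrite /ind (negPf xz) add0e.
have h0 y : 0 <= iter n (act J setT) (ind z) y.
  by apply: iter_act_ge0 => // w; exact: ind_ge0.
have p0 y : 0 <= iter n T (cst 1) y by apply: iter_act_ge0.
rewrite actT_split// -addeA -actD// -[leRHS](actT_cst x ler01).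
rewrite [leRHS]actT_split ?lee_fin//; apply: leeD.
  apply: lee_wpmul2l; rewrite ?lee_fin//; apply: iter_actT_le1 => w.
  exact: ind_le1.
by apply: le_act => // y /= /eqP; exact: IH.
Qed.

Lemma avoid_lt1 x : x != z -> exists n, iter n T (cst 1) x < 1.
Proof.
move=> xz; have [n hn] := Jirr x z; exists n.
have := hit_or_avoid n xz; apply: lt_le_trans.
rewrite lteDr// ge0_fin_numE; last exact: iter_act_ge0.
exact: le_lt_trans (iter_act_le1 _ _ _) (ltry _).
Qed.

(** The potential of a point is bounded: before the chain meets [z], the number
    of visits to [y] is dominated by a geometric variable. *)
Lemma green_ind_bounded y : exists C : R,
  (0 <= C)%R /\ forall x, green J (~` [set z]) (ind y) x <= C%:E.
Proof.
have i0 w : 0 <= ind y w :> \bar R by exact: ind_ge0.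
have [->|yz] := eqVneq y z.
  exists 1%R; split=> // x; apply: le_trans (ind_le1 z x).
  apply: green_min => // [w|w|w]; rewrite ?ind_ge0//.
  rewrite /act esum1 ?adde0// => v /= /eqP/negPf vz.
  by rewrite /ind vz mule0.
have [N pN] := avoid_lt1 yz.
pose U m x : \bar R := \sum_(k < m) iter k T (ind y) x.
have U0 m x : 0 <= U m x by apply: sume_ge0 => k _; exact: iter_act_ge0.
have UE m x : U m.+1 x = ind y x + T (U m) x by exact: iter_act_sumS.
have UfinE m x : U m x = (fine (U m x))%:E.
  rewrite fineK//; apply/sum_fin_numP => k _ _; rewrite ge0_fin_numE.
    by apply: le_lt_trans (iter_act_le1 _ (ind_le1 y) x) _; rewrite ltry.
  exact: iter_act_ge0.
have Umono m x : U m x <= U m.+1 x.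
  by rewrite /U big_ord_recr leeDl//; exact: iter_act_ge0.
pose b m := fine (U m y).
have b0 m : (0 <= b m)%R by apply: fine_ge0; exact: U0.
(* Maximum principle: the expected number of visits to [y] up to a given time
   is largest from [y] itself. *)
have Umax m x : U m x <= (b m)%:E.
  elim: m x => [|m IH] x; first by rewrite /U big_ord0 lee_fin.
  have [->|xy] := eqVneq x y; first by rewrite /b -UfinE.
  rewrite UE /ind (negPf xy) add0e.
  apply: (@le_trans _ _ (b m)%:E); last by rewrite /b -!UfinE.
  by apply: le_trans (act_cst_le x (b0 m)); apply: le_act.
(* At most [n] visits occur during the first [n] steps. *)
have Ustep m n x : U m x <= n%:R%:E + iter n T (U m) x.
  elim: n x => [|n IH] x; first by rewrite add0e.
  apply: le_trans (Umono m x) _; rewrite UE -add1n natrD EFinD -addeA.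
  apply: leeD; first exact: ind_le1.
  apply: (@le_trans _ _ (T (fun w => cst n%:R%:E w + iter n T (U m) w) x)).
    exact: le_act.
  rewrite actD => [||w|w]; first by rewrite leeD2r// act_cst_le.
  - by [].
  - by rewrite lee_fin.
  - exact: iter_act_ge0.
pose p := fine (iter N T (cst 1) y).
have pE : iter N T (cst 1) y = p%:E.
  rewrite fineK// ge0_fin_numE; first exact: lt_trans pN (ltry _).
  exact: iter_act_ge0.
have p1 : (p < 1)%R by rewrite -lte_fin -pE.
have p0 : (0 <= p)%R by rewrite -lee_fin -pE; exact: iter_act_ge0.
have bN k : (b k <= N%:R / (1 - p))%R.
  rewrite ler_pdivlMr ?subr_gt0//.
  have : (b k <= N%:R + b k * p)%R.
    rewrite -lee_fin {1}/b -UfinE; apply: le_trans (Ustep k N y) _.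
    rewrite EFinD leeD2l// EFinM -pE -iter_actZ//.
    by apply: le_iter_act => // w; rewrite mule1.
  lra.
exists (N%:R / (1 - p))%R; split=> [|x].
  by rewrite divr_ge0// subr_ge0 ltW.
apply: le_esum_nat => [n|n]; first exact: iter_act_ge0.
by apply: le_trans (Umax n x) _; rewrite lee_fin.
Qed.

Lemma green_seq_bounded (s : seq S) : exists C : R, (0 <= C)%R /\ forall x,
  green J (~` [set z]) (fun w => (w \in s)%:R%:E) x <= C%:E.
Proof.
elim: s => [|y s [C [C0 IH]]].
  exists 0%R; split=> // x; apply: green_min => // w.
  rewrite /act esum1 ?add0e// => v _.
  by rewrite mule0.
have [D [D0 HD]] := green_ind_bounded y.
exists (D + C)%R; split=> [|x]; first exact: addr_ge0.
pose f w := green J (~` [set z]) (ind y) w +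
  green J (~` [set z]) (fun w => (w \in s)%:R%:E) w.
have s0 (w : S) : 0 <= (w \in s)%:R%:E :> \bar R by rewrite lee_fin.
have i0 (w : S) : 0 <= ind y w :> \bar R by exact: ind_ge0.
apply: (@le_trans _ _ (f x)); last by rewrite EFinD leeD.
apply: green_min => // [w|w]; first by rewrite adde_ge0// green_ge0.
rewrite actD//; do ?by move=> v; apply: green_ge0.
rewrite {1}/f (green_fix _ J0 w i0) (green_fix _ J0 w s0) addeACA leeD2r//.
rewrite inE /ind -EFinD lee_fin -natrD ler_nat.
by case: eqP => //= _; case: (w \in s).
Qed.

(** A Lyapunov function for [q] outside a finite set makes the potential of
    [q] finite. *)
Lemma green_drift_finite (K : {fset S}) (q v : S -> R) (c : R) :
  (forall x, (0 <= q x)%R) -> (forall x, (0 <= v x)%R) ->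
  drift_inequality J K q v c ->
  forall x, green J (~` [set z]) (fun w => (q w)%:E) x < +oo.
Proof.
move=> q0 v0 drift x.
have [C [C0 gC]] := green_seq_bounded K.
pose g w := green J (~` [set z]) (fun w => (w \in K)%:R%:E) w.
have K0 (w : S) : 0 <= (w \in K)%:R%:E :> \bar R by rewrite lee_fin.
have g0 w : 0 <= g w by apply: green_ge0.
(* The term [c 1_K] of the drift is absorbed by the potential of [K]. *)
pose f w := (v w)%:E + `|c|%:E * g w.
have cg0 w : 0 <= `|c|%:E * g w by rewrite mule_ge0// lee_fin.
apply: (@le_lt_trans _ _ (f x)); last first.
  apply: (@le_lt_trans _ _ (v x + `|c| * C)%R%:E); last by rewrite ltry.
  by rewrite EFinD EFinM leeD2l// lee_wpmul2l// lee_fin.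
apply: green_min => // w.
- by rewrite adde_ge0// lee_fin.
- rewrite actD//.
  rewrite actZ// {1}/f {2}/g (green_fix _ J0 w K0) -/g ge0_muleDr//; last first.
    exact: act_ge0.
  rewrite !addeA leeD2r//.
  apply: (@le_trans _ _ ((q w)%:E + (v w - q w + c * (w \in K)%:R)%:E)).
    rewrite leeD2l//; apply: le_trans (drift w).
    have := @act_le_actT (fun y => (v y)%:E) w.
    rewrite /act => H; apply: le_trans (H _) _.
      by move=> y; rewrite lee_fin.
    by apply: le_esum => y _; rewrite EFinM.
  rewrite -EFinM -!EFinD lee_fin.
  have : (c * (w \in K)%:R <= `|c| * (w \in K)%:R)%R.
    by rewrite ler_wpM2r ?ler_norm.
  lra.
Qed.

End Taboo.

(** * The invariant measure and the cycle formula *)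

Section Invariant.
Local Open Scope ereal_scope.
Context {R : realType} {S : countType} (J : S -> S -> R).
Context (J0 : forall x y, (0 <= J x y)%R)
  (J1 : forall x, \esum_(y in setT) (J x y)%:E = 1)
  (Jirr : forall x y, exists n, 0 < iter n (act J setT) (ind y) x).
Implicit Type mu : S -> R.

(** Non-negative measures [mu] with [mu J = mu]. *)
Definition stationary mu : Prop :=
  (forall x, (0 <= mu x)%R) /\
  forall y, \esum_(x in setT) (mu x * J x y)%:E = (mu y)%:E.

Lemma stationary_pairing mu f : stationary mu -> (forall y, 0 <= f y) ->
  \esum_(x in setT) ((mu x)%:E * act J setT f x) =
  \esum_(y in setT) ((mu y)%:E * f y).
Proof.
move=> [mu0 inv] f0.
have -> : \esum_(x in setT) ((mu x)%:E * act J setT f x) =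
    \esum_(x in setT) \esum_(y in setT) ((mu x)%:E * ((J x y)%:E * f y)).
  apply: eq_esum => x _; rewrite esumZ// => y _.
  by rewrite mule_ge0// lee_fin.
rewrite esum_exchange; last first.
  by move=> x y; rewrite mule_ge0 ?lee_fin// mule_ge0// lee_fin.
apply: eq_esum => y _; rewrite -inv.
rewrite [RHS]muleC; case: (f y) (f0 y) => [r r0||//].
- rewrite -esumZ//; last by move=> x _; rewrite lee_fin mulr_ge0.
  by apply: eq_esum => x _; rewrite muleA -EFinM muleC.
- move=> _; have [muy|muy] := eqVneq (mu y) 0%R.
    rewrite inv muy mule0; apply: esum1 => x _.
    have := inv y; rewrite muy => h.
    have := esum_eq0P _ h (x := x); rewrite muleA -EFinM => -> //.
    - by rewrite mul0e.
    - by move=> w _; rewrite lee_fin mulr_ge0.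
  rewrite inv gt0_mulye; last by rewrite lte_fin lt_neqAle eq_sym muy mu0.
  apply/eqP; rewrite -leye_eq.
  have [x hx] : exists x, (mu x * J x y != 0)%R.
    apply: contrapT => /forallNP h; case/eqP: muy; apply/EFin_inj; rewrite -inv.
    by apply: esum1 => x _; have /negP/negPn/eqP -> := h x.
  apply: le_trans (esum_ge_term (x := x) _ _) => //; last first.
    by move=> w _; rewrite mule_ge0 ?lee_fin// mule_ge0 ?lee_fin.
  rewrite muleA -EFinM gt0_muley// lte_fin lt_neqAle eq_sym hx.
  by rewrite mulr_ge0.
Qed.

(** By irreducibility, a stationary measure that vanishes at a point is zero:
    its zero set is closed under predecessors. *)
Lemma stationary_eq0 mu z : stationary mu -> mu z = 0%R -> forall y, mu y = 0%R.
Proof.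
move=> [mu0 inv] muz y; have [n] := Jirr y z.
elim: n y => [|n IH] y /=.
  by rewrite /ind; case: eqP => [->//|]; rewrite ltxx.
have f0 x : 0 <= iter n (act J setT) (ind z) x.
  by apply: iter_act_ge0 => // w; exact: ind_ge0.
move=> pos.
have [x] : exists x, 0 < (J y x)%:E * iter n (act J setT) (ind z) x.
  apply: contrapT => /forallNP h; move: pos; rewrite /act esum1 ?ltxx// => x _.
  apply/eqP; rewrite eq_le; apply/andP; split; last first.
    by rewrite mule_ge0// lee_fin.
  by rewrite leNgt; apply/negP; exact: h.
move=> hx.
have Jyx : (J y x != 0)%R by apply: contraTneq hx => ->; rewrite mul0e ltxx.
have fx : 0 < iter n (act J setT) (ind z) x.
  rewrite lt_neqAle f0 andbT eq_sym.
  by apply: contraTneq hx => ->; rewrite mule0 ltxx.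
have := inv x; rewrite (IH _ fx) => h.
have h0 w : [set: S] w -> 0 <= (mu w * J w x)%:E.
  by move=> _; rewrite lee_fin mulr_ge0.
have /eqP := esum_eq0P h0 h (x := y) I.
by rewrite eqe mulf_eq0 (negPf Jyx) orbF => /eqP.
Qed.

Context (z : S).
Local Notation T := (act J (~` [set z])).
(* Recurrence: the chain started at [z] almost surely returns to [z]. *)
Context (rec : forall e : R, (0 < e)%R -> exists n, iter n T (cst 1) z < e%:E).

Let i0 (y w : S) : 0 <= ind y w :> \bar R. Proof. exact: ind_ge0. Qed.

Lemma green_esum (q : S -> R) x : (forall y, (0 <= q y)%R) ->
  green J (~` [set z]) (fun w => (q w)%:E) x =
  \esum_(y in setT) ((q y)%:E * green J (~` [set z]) (ind y) x).
Proof.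
move=> q0; rewrite /green.
under eq_esum do rewrite iter_act_ind//.
rewrite esum_exchange; last first.
  by move=> n y; rewrite mule_ge0 ?lee_fin//; exact: iter_act_ge0.
by apply: eq_esum => y _; rewrite esumZ// => n _; exact: iter_act_ge0.
Qed.

(** [mu(y)] dominates [mu(z)] times the mean number of visits to [y] during a
    cycle: iterating stationarity [N] times splits [mu(y)] according to the last
    visit to [z], with a non-negative remainder. *)
Lemma stationary_ge_cycle mu y : stationary mu ->
  (mu z)%:E * green J (~` [set z]) (ind y) z <= (mu y)%:E.
Proof.
move=> smu; have [mu0 inv] := smu.
rewrite /green -esumZ//; last by move=> n _; exact: iter_act_ge0.
apply: le_esum_nat => [n|N].
  by rewrite mule_ge0 ?lee_fin//; exact: iter_act_ge0.
suff <- : \sum_(k < N) (mu z)%:E * iter k T (ind y) z +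
    \esum_(x in setT) ((mu x)%:E * iter N T (ind y) x) = (mu y)%:E.
  rewrite leeDl//; apply: esum_ge0 => x _; rewrite mule_ge0 ?lee_fin//.
  exact: iter_act_ge0.
elim: N => [|N IH].
  rewrite big_ord0 add0e (esum_ind y mu0); apply: eq_esum => x _.
  by rewrite /ind eq_sym.
rewrite -IH big_ord_recr -addeA; congr (_ + _).
have fN x : 0 <= iter N T (ind y) x by apply: iter_act_ge0.
rewrite -[RHS]stationary_pairing//.
transitivity (\esum_(x in setT) ((mu x)%:E * ((J x z)%:E * iter N T (ind y) z) +
    (mu x)%:E * T (iter N T (ind y)) x)).
  rewrite esumD; last 2 first.
  - by move=> x _; rewrite mule_ge0 ?lee_fin// mule_ge0 ?lee_fin.
  - by move=> x _; rewrite mule_ge0 ?lee_fin//; apply: act_ge0.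
  congr (_ + _).
  have := stationary_pairing smu
    (f := fun w => if w == z then iter N T (ind y) z else 0) _.
  have -> : \esum_(w in setT)
      ((mu w)%:E * (if w == z then iter N T (ind y) z else 0)) =
      (mu z)%:E * iter N T (ind y) z.
    rewrite (esumID [set z])//; last first.
      by move=> x _; rewrite mule_ge0 ?lee_fin//; case: ifP.
    rewrite setTI esum_set1 ?eqxx; last by rewrite mule_ge0 ?lee_fin.
    rewrite esum1 ?adde0// => x [_ /= /eqP/negPf ->].
    by rewrite mule0.
  move=> <-; last by move=> w; case: ifP.
  apply: eq_esum => x _; congr (_ * _).
  rewrite (actT_split z J0); last by move=> w; case: ifP.
  rewrite eqxx /act esum1 ?adde0// => w /= /eqP/negPf ->.
  by rewrite mule0.
apply: eq_esum => x _; rewrite (actT_split z J0)// ge0_muleDr//.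
- by rewrite mule_ge0 ?lee_fin.
- exact: act_ge0.
Qed.

(** The expected number of visits to [y] during a cycle from [z] to [z]. *)
Let m (y : S) : R := fine (green J (~` [set z]) (ind y) z).

Let mE y : green J (~` [set z]) (ind y) z = (m y)%:E.
Proof.
rewrite /m fineK// ge0_fin_numE; last exact: green_ge0.
have [C [C0 hC]] := green_ind_bounded z J0 J1 Jirr y.
exact: le_lt_trans (hC z) (ltry _).
Qed.

Let m0 y : (0 <= m y)%R.
Proof. by apply: fine_ge0; exact: green_ge0. Qed.

Let m_z : m z = 1%R.
Proof.
apply/EFin_inj; rewrite -mE (green_fix _ J0)// /act esum1.
  by rewrite adde0 /ind eqxx.
move=> w /= /eqP wz; rewrite (_ : green _ _ _ _ = 0) ?mule0//.
apply/eqP; rewrite eq_le green_ge0// andbT.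
apply: (@le_trans _ _ (if w == z then 1 else 0)); last by rewrite (negPf wz).
apply: (@green_min _ _ _ _ J0 _ (fun v => if v == z then 1 else 0)) => // v.
by case: ifP.
rewrite /act esum1 ?adde0; first by rewrite /ind; case: eqP.
by move=> u /= /eqP/negPf ->; rewrite mule0.
Qed.

(** The return probabilities to [z], summed over the first return times. *)
Lemma esum_iter_return :
  \esum_(n in setT) iter n T (fun x => (J x z)%:E) z = 1.
Proof.
have Jz0 x : 0 <= (J x z)%:E by rewrite lee_fin.
have partial N :
    \sum_(k < N) iter k T (fun x => (J x z)%:E) z + iter N T (cst 1) z = 1.
  elim: N => [|N IH]; first by rewrite big_ord0 add0e.
  rewrite -[RHS]IH big_ord_recr -addeA; congr (_ + _).
  rewrite iterSr /= -iter_actD//; last by move=> y; exact: act_ge0.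
  congr (iter N T _ z); apply/funext => x /=.
  have := actT_cst J0 J1 x ler01; rewrite (actT_split z J0)//.
  by rewrite mule1.
apply/eqP; rewrite eq_le; apply/andP; split.
  apply: le_esum_nat => [n|n]; first exact: iter_act_ge0.
  by rewrite -(partial n) leeDl//; exact: iter_act_ge0.
apply/lee_addgt0Pr => e e0.
have [n hn] := rec e0.
rewrite -(partial n); apply: leeD; last exact: ltW.
rewrite -nneseries_esumT; last by move=> k; exact: iter_act_ge0.
rewrite -(big_mkord xpredT (fun k => iter k T (fun x => (J x z)%:E) z)).
by apply: nneseries_lim_ge => k _ _; exact: iter_act_ge0.
Qed.

(** The mean occupation measure of a cycle is stationary. *)
Lemma stationary_cycle : stationary m.
Proof.
split=> // y.
have -> : \esum_(x in setT) (m x * J x y)%:E =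
    green J (~` [set z]) (fun x => (J x y)%:E) z.
  rewrite green_esum//; apply: eq_esum => x _.
  by rewrite mE -EFinM mulrC.
have [->|yz] := eqVneq y z; first by rewrite m_z /green esum_iter_return.
have -> : (fun x => (J x y)%:E) = T (ind y).
  apply/funext => x; rewrite /act (esumID [set y]); last first.
    by move=> w _; rewrite mule_ge0 ?lee_fin//.
  have -> : ~` [set z] `&` [set y] = [set y].
    apply/seteqP; split=> w; first by case.
    by move=> /= ->; split=> //; apply/eqP.
  rewrite esum_set1; last by rewrite mule_ge0 ?lee_fin.
  rewrite /ind eqxx mule1 esum1 ?adde0// => w [_ /= /eqP/negPf ->].
  by rewrite mule0.
rewrite -mE /green [RHS]esum_natS; last by move=> n; exact: iter_act_ge0.
rewrite [X in _ = X + _](_ : _ = 0); last first.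
  by rewrite /= /ind eq_sym (negPf yz).
by rewrite add0e; apply: eq_esum => n _; rewrite -iterSr.
Qed.

(** A stationary measure is proportional to the mean occupation measure of a
    cycle, so that its integrals are mean sums over a cycle. *)
Lemma stationary_integral mu (q : S -> R) : stationary mu ->
  (forall x, (0 <= q x)%R) ->
  \esum_(x in setT) (mu x * q x)%:E =
  (mu z)%:E * green J (~` [set z]) (fun w => (q w)%:E) z.
Proof.
move=> smu q0; have [mu0 inv] := smu.
(* The excess over the cycle measure is stationary and vanishes at [z]. *)
pose nu y := (mu y - mu z * m y)%R.
have nu0 y : (0 <= nu y)%R.
  rewrite subr_ge0 -lee_fin EFinM -mE; exact: stationary_ge_cycle.
have snu : stationary nu.
  split=> // y.
  have [_ invm] := stationary_cycle.
  have cm0 x : (0 <= mu z * (m x * J x y))%R by rewrite !mulr_ge0.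
  have Ecm : \esum_(x in setT) (mu z * (m x * J x y))%:E = (mu z * m y)%:E.
    rewrite EFinM -invm -esumZ//.
    by move=> x _; rewrite lee_fin mulr_ge0.
  have : \esum_(x in setT) (nu x * J x y)%:E + (mu z * m y)%:E = (mu y)%:E.
    rewrite -Ecm -inv -esumD.
    - apply: eq_esum => x _; rewrite -EFinD; congr (_%:E).
      by rewrite /nu mulrBl mulrA subrK.
    - by move=> x _; rewrite lee_fin mulr_ge0.
    - by move=> x _; rewrite lee_fin.
  by move=> h; rewrite [in RHS]/nu EFinB -h addeK.
have nuz : nu z = 0%R by rewrite /nu m_z mulr1 subrr.
rewrite green_esum// -esumZ//; last first.
  by move=> y _; rewrite mule_ge0 ?lee_fin//; exact: green_ge0.
apply: eq_esum => y _; have /subr0_eq -> := stationary_eq0 snu nuz y.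
by rewrite mE -!EFinM -mulrA (mulrC (m y)).
Qed.

End Invariant.

(** * Inverses of non-negative matrices with a strict supersolution *)

Section InvBlock.
Context {R : realType} {S : countType}.
Implicit Types (B : {fset S}) (M : S -> S -> R) (f g w : S -> R).

(** The enumeration of [B] used by [inv_block] to index its matrices. *)
Definition entry B (i : 'I_#|{: B}|) : S := val (enum_val i).

Lemma entry_in B (i : 'I_#|{: B}|) : entry i \in B.
Proof. exact: valP. Qed.

Lemma entryP B x : x \in B -> exists i : 'I_#|{: B}|, x = entry i.
Proof.
move=> xB; exists (enum_rank [` xB]%fset).
by rewrite /entry enum_rankK.
Qed.

Lemma sum_entry B (h : S -> R) :
  \sum_(a <- B) h a = \sum_(i < #|{: B}|) h (entry i).
Proof.
rewrite big_seq_fsetE /=.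
rewrite (reindex (@enum_val B {: B})) /=; last first.
  exact: onW_bij (enum_val_bij _).
by apply: eq_bigl => i.
Qed.

Lemma inv_block_entry B M (i j : 'I_#|{: B}|) :
  inv_block B M (entry i) (entry j) =
  invmx (1%:M - \matrix_(i < #|{: B}|, j < #|{: B}|) M (entry i) (entry j)) i j.
Proof. by rewrite /inv_block /entry !valK !enum_valK. Qed.

Lemma mulv_on_le B M f g x : (forall a, a \in B -> 0 <= M x a) ->
  (forall a, a \in B -> f a <= g a) -> mulv_on B M f x <= mulv_on B M g x.
Proof.
move=> M0 fg; rewrite /mulv_on big_seq [leRHS]big_seq.
by apply: ler_sum => a aB; rewrite ler_wpM2l ?M0 ?fg.
Qed.

Lemma mulv_on_ge0 B M f x : (forall a, a \in B -> 0 <= M x a) ->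
  (forall a, a \in B -> 0 <= f a) -> 0 <= mulv_on B M f x.
Proof.
move=> M0 f0; rewrite /mulv_on big_seq; apply: sumr_ge0 => a aB.
by rewrite mulr_ge0 ?M0 ?f0.
Qed.

Lemma eq_mulv_on B M f g x : (forall a, a \in B -> f a = g a) ->
  mulv_on B M f x = mulv_on B M g x.
Proof. by move=> fg; apply: eq_big_seq => a /fg ->. Qed.

Lemma mulv_onD B M f g x :
  mulv_on B M (fun y => f y + g y) x = mulv_on B M f x + mulv_on B M g x.
Proof. by rewrite /mulv_on -big_split; apply: eq_bigr => a _; rewrite mulrDr. Qed.

Lemma mulv_onZ B M (c : R) f x :
  mulv_on B M (fun y => f y * c) x = mulv_on B M f x * c.
Proof. by rewrite /mulv_on mulr_suml; apply: eq_bigr => a _; rewrite mulrA. Qed.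

Lemma mulv_onB B M f g x :
  mulv_on B M (fun y => f y - g y) x = mulv_on B M f x - mulv_on B M g x.
Proof. by rewrite /mulv_on -sumrB; apply: eq_bigr => a _; rewrite mulrBr. Qed.

Lemma mulv_on_mulm B C M N f x :
  mulv_on C (mulm_on B M N) f x = mulv_on B M (mulv_on C N f) x.
Proof.
rewrite /mulv_on /mulm_on.
under eq_bigr do rewrite mulr_suml.
rewrite exchange_big; apply: eq_bigr => a _.
by rewrite mulr_sumr; apply: eq_bigr => b _; rewrite mulrA.
Qed.

(* From here on, [g] is a strict supersolution of [M] on [B]. *)
Context (B : {fset S}) (M : S -> S -> R) (g : S -> R).
Context (M0 : forall x y, x \in B -> y \in B -> 0 <= M x y)
  (g0 : forall x, x \in B -> 0 < g x)
  (Mg : forall x, x \in B -> mulv_on B M g x < g x).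

(** Minimum principle. *)
Lemma supersolution_ge0 w : (forall x, x \in B -> mulv_on B M w x <= w x) ->
  forall x, x \in B -> 0 <= w x.
Proof.
move=> Mw x xB.
(* At a minimum of [w / g], a negative value [r] of [w / g] would make [r g]
   minorize [w] with equality there, against [M g < g]. *)
have [i _ imin] := @arg_minP _ _ _ [` xB]%fset xpredT
  (fun i : B => w (val i) / g (val i)) isT.
set r := w (val i) / g (val i).
have iB : val i \in B by exact: valP.
have rg y : y \in B -> r * g y <= w y.
  move=> yB; have := imin [` yB]%fset isT.
  by rewrite ler_pdivlMr ?g0.
have r0 : 0 <= r.
  rewrite leNgt; apply/negP => r0.
  have := Mw _ iB; apply/negP; rewrite -ltNge.
  have -> : w (val i) = r * g (val i) by rewrite /r divfK// gt_eqF// g0.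
  apply: (@lt_le_trans _ _ (mulv_on B M (fun y => g y * r) (val i))).
    by rewrite mulv_onZ mulrC ltr_nM2r// Mg.
  by apply: mulv_on_le => [a aB|a aB]; [exact: M0|rewrite mulrC; exact: rg].
apply: le_trans (rg x xB).
by rewrite mulr_ge0// ltW// g0.
Qed.

Lemma comparison f w w' :
  (forall x, x \in B -> w' x <= f x + mulv_on B M w' x) ->
  (forall x, x \in B -> f x + mulv_on B M w x <= w x) ->
  forall x, x \in B -> w' x <= w x.
Proof.
move=> hw' hw x xB; rewrite -subr_ge0.
apply: (supersolution_ge0 (w := fun y => w y - w' y)) => // y yB.
rewrite mulv_onB; have := hw' _ yB; have := hw _ yB; lra.
Qed.

Let Mx := \matrix_(i < #|{: B}|, j < #|{: B}|) M (entry i) (entry j).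

Let Mx_unit : 1%:M - Mx \in unitmx.
Proof.
rewrite -unitmx_tr unitmxE unitfE; apply/negP => /det0P[v v0].
move=> /(congr1 trmx); rewrite trmx_mul trmxK trmx0 => Av.
pose w x := if insub x is Some u then v ord0 (@enum_rank B u) else 0.
have wE i : w (entry i) = v ord0 i by rewrite /w /entry valK enum_valK.
have Mw x : x \in B -> mulv_on B M w x = w x.
  move=> /entryP[i ->]; rewrite /mulv_on sum_entry wE.
  move/matrixP: Av => /(_ i ord0).
  rewrite mulmxBl mul1mx !mxE => /eqP; rewrite subr_eq0 => /eqP ->.
  by apply: eq_bigr => j _; rewrite !mxE wE.
have w0 x : x \in B -> w x = 0.
  move=> xB; apply/eqP; rewrite eq_le; apply/andP; split.
    apply: (comparison (f := fun=> 0) (w := fun=> 0)) => // y yB.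
      by rewrite add0r Mw.
    by rewrite add0r /mulv_on big1// => a _; rewrite mulr0.
  by apply: supersolution_ge0 => // y yB; rewrite Mw.
case/negP: v0; apply/eqP/matrixP => k i.
by rewrite (ord1 k) -wE w0 ?entry_in// mxE.
Qed.

(** [(I - M_BB)^-1 f] solves [w = f + M w] on [B]. *)
Lemma inv_block_fix f x : x \in B ->
  mulv_on B (inv_block B M) f x =
  f x + mulv_on B M (mulv_on B (inv_block B M) f) x.
Proof.
pose F : 'cV_#|{: B}| := \col_i f (entry i).
pose W := invmx (1%:M - Mx) *m F.
have wE i : mulv_on B (inv_block B M) f (entry i) = W i ord0.
  rewrite /mulv_on sum_entry /W mxE; apply: eq_bigr => j _.
  by rewrite inv_block_entry !mxE.
move=> /entryP[i ->].
have ME h : mulv_on B M h (entry i) =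
    \sum_(j < #|{: B}|) M (entry i) (entry j) * h (entry j).
  by rewrite /mulv_on sum_entry.
rewrite ME wE.
have : (1%:M - Mx) *m W = F by rewrite mulKVmx.
move=> /matrixP/(_ i ord0); rewrite mulmxBl mul1mx !mxE => /eqP.
rewrite subr_eq => /eqP ->; congr (_ + _).
by apply: eq_bigr => j _; rewrite wE !mxE.
Qed.

Lemma inv_block_le f w : (forall x, x \in B -> w x <= f x + mulv_on B M w x) ->
  forall x, x \in B -> w x <= mulv_on B (inv_block B M) f x.
Proof.
by move=> hw; apply: (comparison (f := f)) => // x xB; rewrite -inv_block_fix.
Qed.

Lemma inv_block_ge f w : (forall x, x \in B -> f x + mulv_on B M w x <= w x) ->
  forall x, x \in B -> mulv_on B (inv_block B M) f x <= w x.
Proof.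
by move=> hw; apply: (comparison (f := f)) => // x xB; rewrite -inv_block_fix.
Qed.

Lemma inv_block_ge0 x y : x \in B -> 0 <= inv_block B M x y.
Proof.
move=> xB; have [yB|yB] := boolP (y \in B); last first.
  rewrite /inv_block; case: (insub x) => // u.
  by rewrite insubF//; exact/negbTE.
pose f a : R := (a == y)%:R.
have nE a : inv_block B M a y = mulv_on B (inv_block B M) f a.
  rewrite /mulv_on (big_fsetD1 y)//= /f eqxx mulr1 big_seq big1 ?addr0// => b.
  by rewrite in_fsetD1 => /andP[/negPf -> _]; rewrite mulr0.
rewrite nE; apply: (@inv_block_le f (fun=> 0)) => // a aB.
by rewrite /mulv_on big1 ?addr0 /f// => b _; rewrite mulr0.
Qed.

End InvBlock.

(** * Linear bounds from a finite truncation *)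

Section Truncation.
Context {R : realType} {S : countType}.
Context (J : S -> S -> R) (K A : {fset S}) (z : S) (g : S -> R).
(* [g] is a strict supersolution on [A - {z}]; it makes the inverses of
   [I - R_22] and [I - G] exist and be non-negative. *)
Context (J0 : forall x y, 0 <= J x y) (zK : z \in K) (KA : (K `<=` A)%fset)
  (g1 : forall x, x \in (A `\ z)%fset -> 1 <= g x)
  (Jg : forall x, x \in (A `\ z)%fset -> 1 + mulv_on (A `\ z)%fset J g x <= g x).
Implicit Types (f w q v : S -> R).

Local Notation Ap := (Aprime K A).
Local Notation Kt := (Ktilde K z).
Local Notation N22 := (N22 J K A).
Local Notation N22_R21 := (N22_R21 J K A).
Local Notation Gmat := (Gmat J K A).

Lemma in_Kt x : x \in Kt -> x \in K.
Proof. by rewrite in_fsetD1 => /andP[]. Qed.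

Lemma Kt_Az x : x \in Kt -> x \in (A `\ z)%fset.
Proof. by rewrite !in_fsetD1 => /andP[-> /(fsubsetP KA)]. Qed.

Lemma Ap_notin_K x : x \in Ap -> x \notin K.
Proof. by rewrite in_fsetD => /andP[]. Qed.

Lemma Ap_Az x : x \in Ap -> x \in (A `\ z)%fset.
Proof.
rewrite in_fsetD1 in_fsetD => /andP[xK ->]; rewrite andbT.
by apply: contraNneq xK => ->.
Qed.

Lemma Az_cases x : x \in (A `\ z)%fset -> (x \in Kt) || (x \in Ap).
Proof.
rewrite !in_fsetD1 in_fsetD => /andP[-> ->]; rewrite andbT /=.
by case: (x \in K).
Qed.

Lemma mulv_on_Az M f x :
  mulv_on (A `\ z)%fset M f x = mulv_on Kt M f x + mulv_on Ap M f x.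
Proof.
rewrite /mulv_on (big_fsetID _ (mem K)) /=; congr (_ + _); apply: eq_fbigl => y.
- rewrite !inE /=; apply/andP/andP => [[/andP[-> _] ->]|[-> yK]] //.
  by rewrite (fsubsetP KA).
- rewrite !inE /=; apply/andP/andP => [[/andP[_ ->] ->]|[yK ->]] //.
  by rewrite yK (contraNneq _ yK)// => ->.
Qed.

Lemma mulv_on_A M f x :
  mulv_on A M f x = mulv_on K M f x + mulv_on Ap M f x.
Proof.
rewrite /mulv_on (big_fsetID _ (mem K)) /=; congr (_ + _); apply: eq_fbigl => y.
- rewrite !inE /=; apply/andP/idP => [[_ ->]|yK] //.
  by rewrite (fsubsetP KA).
- by rewrite !inE /= andbC.
Qed.

Let g0 x : x \in (A `\ z)%fset -> 0 < g x.
Proof. by move=> /g1; apply: lt_le_trans. Qed.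

Let ApM0 x y : x \in Ap -> y \in Ap -> 0 <= J x y. Proof. by []. Qed.

Let Apg0 x : x \in Ap -> 0 < g x. Proof. by move=> /Ap_Az; exact: g0. Qed.

Let ApMg x : x \in Ap -> mulv_on Ap J g x < g x.
Proof.
move=> xA; have := Jg (Ap_Az xA); rewrite mulv_on_Az.
have : 0 <= mulv_on Kt J g x.
  by apply: mulv_on_ge0 => // a /Kt_Az/g0/ltW.
lra.
Qed.

Lemma N22_ge0 x y : x \in Ap -> 0 <= N22 x y.
Proof. exact: (inv_block_ge0 ApM0 Apg0 ApMg). Qed.

Lemma N22_R21_ge0 x y : x \in Ap -> 0 <= N22_R21 x y.
Proof.
move=> xA; rewrite /N22_R21 /mulm_on; apply: sumr_ge0 => a _.
by rewrite mulr_ge0// N22_ge0.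
Qed.

Lemma Gmat_ge0 x y : 0 <= Gmat x y.
Proof.
rewrite addr_ge0// /R12_N22_R21 /mulm_on big_seq; apply: sumr_ge0 => a aA.
by rewrite mulr_ge0// N22_R21_ge0.
Qed.

(** The function [q_1 + R_12 (I - R_22)^-1 q_2] on [K]. *)
Definition reduced f (x : S) : R := f x + mulv_on Ap J (mulv_on Ap N22 f) x.

Lemma mulv_on_N22_R21 B f x :
  mulv_on B N22_R21 f x = mulv_on Ap N22 (mulv_on B J f) x.
Proof. exact: mulv_on_mulm. Qed.

Lemma mulv_on_Gmat f x :
  mulv_on Kt Gmat f x = mulv_on Kt J f x + mulv_on Ap J (mulv_on Kt N22_R21 f) x.
Proof.
rewrite -mulv_on_mulm /mulv_on -big_split; apply: eq_bigr => a _ /=.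
by rewrite -mulrDl.
Qed.

(** Elimination of [A'] from a system of inequalities on [A - {z}]. *)
Lemma eliminate_ge f w :
  (forall x, x \in (A `\ z)%fset -> f x + mulv_on (A `\ z)%fset J w x <= w x) ->
  (forall x, x \in Ap ->
     mulv_on Ap N22 f x + mulv_on Kt N22_R21 w x <= w x) /\
  (forall x, x \in Kt -> reduced f x + mulv_on Kt Gmat w x <= w x).
Proof.
move=> hw.
have hA x : x \in Ap -> mulv_on Ap N22 f x + mulv_on Kt N22_R21 w x <= w x.
  move=> xA; rewrite mulv_on_N22_R21 -mulv_onD.
  apply: (inv_block_ge ApM0 Apg0 ApMg) => // y yA.
  by have := hw _ (Ap_Az yA); rewrite mulv_on_Az addrA.
split=> // x xK; apply: le_trans (hw _ (Kt_Az xK)).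
rewrite mulv_on_Gmat mulv_on_Az /reduced -!addrA lerD2l addrCA lerD2l.
by rewrite -mulv_onD; apply: mulv_on_le.
Qed.

Lemma eliminate_le f w :
  (forall x, x \in (A `\ z)%fset -> w x <= f x + mulv_on (A `\ z)%fset J w x) ->
  (forall x, x \in Ap ->
     w x <= mulv_on Ap N22 f x + mulv_on Kt N22_R21 w x) /\
  (forall x, x \in Kt -> w x <= reduced f x + mulv_on Kt Gmat w x).
Proof.
move=> hw.
have hA x : x \in Ap -> w x <= mulv_on Ap N22 f x + mulv_on Kt N22_R21 w x.
  move=> xA; rewrite mulv_on_N22_R21 -mulv_onD.
  apply: (inv_block_le ApM0 Apg0 ApMg) => // y yA.
  by have := hw _ (Ap_Az yA); rewrite mulv_on_Az addrA.
split=> // x xK; apply: le_trans (hw _ (Kt_Az xK)) _.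
rewrite mulv_on_Gmat mulv_on_Az /reduced -!addrA lerD2l addrCA lerD2l.
by rewrite -mulv_onD; apply: mulv_on_le.
Qed.

Let KtM0 x y : x \in Kt -> y \in Kt -> 0 <= Gmat x y.
Proof. by move=> _ _; exact: Gmat_ge0. Qed.

Let Ktg0 x : x \in Kt -> 0 < g x. Proof. by move=> /Kt_Az; exact: g0. Qed.

Let KtMg x : x \in Kt -> mulv_on Kt Gmat g x < g x.
Proof.
move=> xK; have [_ /(_ _ xK)] := eliminate_ge (f := fun=> 1) Jg.
have : 0 <= mulv_on Ap J (mulv_on Ap N22 (fun=> 1)) x.
  apply: mulv_on_ge0 => // a aA; apply: mulv_on_ge0 => // b _.
  exact: N22_ge0.
rewrite /reduced; lra.
Qed.

Lemma invG_ge0 x y : x \in Kt -> 0 <= invG J K A z x y.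
Proof. exact: (inv_block_ge0 KtM0 Ktg0 KtMg). Qed.

Lemma kqK q x : x \in K -> kq J K A q x = reduced q x.
Proof. by rewrite /kq => ->. Qed.

Lemma kqAp q x : x \in Ap -> kq J K A q x = mulv_on Ap N22 q x.
Proof. by move=> /Ap_notin_K; rewrite /kq => /negPf ->. Qed.

(** A supersolution [u] of [q + J_(A - {z}) u <= u] on [A] dominates the lower
    quantities. *)
Section Lower.
Context (q u : S -> R) (q0 : forall x, 0 <= q x)
  (hu : forall x, x \in A -> q x + mulv_on (A `\ z)%fset J u x <= u x).

Let huz x : x \in (A `\ z)%fset -> q x + mulv_on (A `\ z)%fset J u x <= u x.
Proof. by rewrite in_fsetD1 => /andP[_]; exact: hu. Qed.

Lemma kq_ge0 x : x \in (A `\ z)%fset -> 0 <= kq J K A q x.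
Proof.
move=> /Az_cases /orP[xK|xA].
  rewrite kqK ?in_Kt// addr_ge0//; apply: mulv_on_ge0 => // a aA.
  by apply: mulv_on_ge0 => // b _; exact: N22_ge0.
by rewrite kqAp//; apply: mulv_on_ge0 => // b _; exact: N22_ge0.
Qed.

Lemma lower_Kt_ge0 x : x \in Kt -> 0 <= lower_Kt J K A z q x.
Proof.
move=> xK; apply: mulv_on_ge0 => [a _|a /Kt_Az]; first exact: invG_ge0.
exact: kq_ge0.
Qed.

Lemma lower_Az_ge0 x : x \in (A `\ z)%fset -> 0 <= lower_Az J K A z q x.
Proof.
move=> xAz; rewrite /lower_Az; case: ifP => xK.
  by apply: lower_Kt_ge0; move: xAz; rewrite !in_fsetD1 xK => /andP[->].
move: (Az_cases xAz) => /orP[/in_Kt|xA]; first by rewrite xK.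
rewrite addr_ge0 ?kq_ge0//; apply: mulv_on_ge0 => a; last exact: lower_Kt_ge0.
by move=> _; exact: N22_R21_ge0.
Qed.

Lemma lower_kappa_z_ge : q z <= lower_kappa J K A z q z.
Proof.
rewrite /lower_kappa eqxx lerDl; apply: mulv_on_ge0 => //.
exact: lower_Az_ge0.
Qed.

Lemma lower_kappa_ge0 x : x \in A -> 0 <= lower_kappa J K A z q x.
Proof.
move=> xA; have [->|xz] := eqVneq x z.
  exact: le_trans (q0 z) lower_kappa_z_ge.
by rewrite /lower_kappa (negPf xz) lower_Az_ge0// in_fsetD1 xz.
Qed.

Lemma lower_Kt_le x : x \in Kt -> lower_Kt J K A z q x <= u x.
Proof.
have [_ hK] := eliminate_ge huz.
apply: (inv_block_ge KtM0 Ktg0 KtMg) => y yK.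
by rewrite kqK ?in_Kt ?hK.
Qed.

Lemma lower_Az_le x : x \in (A `\ z)%fset -> lower_Az J K A z q x <= u x.
Proof.
move=> xAz; rewrite /lower_Az; case: ifP => xK.
  by apply: lower_Kt_le; move: xAz; rewrite !in_fsetD1 xK => /andP[->].
move: (Az_cases xAz) => /orP[/in_Kt|xA]; first by rewrite xK.
have [hA _] := eliminate_ge huz; apply: le_trans (hA x xA).
rewrite kqAp// lerD2l; apply: mulv_on_le; last exact: lower_Kt_le.
by move=> a _; exact: N22_R21_ge0.
Qed.

Lemma lower_kappa_le x : x \in A -> lower_kappa J K A z q x <= u x.
Proof.
move=> xA; rewrite /lower_kappa; case: eqVneq xA => [-> zA|xz xA].
  apply: le_trans (hu zA); rewrite lerD2l; apply: mulv_on_le => //.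
  exact: lower_Az_le.
by apply: lower_Az_le; rewrite in_fsetD1 xz.
Qed.

End Lower.

Lemma norm_on_ge B f x : x \in B -> `|f x| <= norm_on B f.
Proof. by move=> xB; exact: (le_bigmax_seq 0 x xpredT (fun y => `|f y|) xB isT). Qed.

Lemma norm_on_ge0 B f : 0 <= norm_on B f.
Proof. exact: bigmax_ge_id. Qed.

Lemma norm_on_le B f (c : R) : 0 <= c -> (forall x, x \in B -> `|f x| <= c) ->
  norm_on B f <= c.
Proof. by move=> c0 fc; rewrite /norm_on big_seq; apply: bigmax_le. Qed.

(** Dually, the upper quantities dominate a subsolution [u]. *)
Section Upper.
(* [r x] is the probability of a jump from [x] out of [A]. Outside [A], the
   function [u] may be replaced by [v + c] for any [c] above [u] on
   [K - {z}]. *)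
Context (r q v u : S -> R) (u0 : forall x, 0 <= u x)
  (r0 : forall x, 0 <= r x)
  (rE : forall x, r x = 1 - \sum_(y <- A) J x y)
  (offE : forall c x, 0 <= c ->
     mulv_off A J (fun y => v y + c) x = mulv_off A J v x + r x * c)
  (hu : forall c x, 0 <= c -> (forall y, y \in Kt -> u y <= c) -> x \in A ->
     u x <= q x + mulv_on (A `\ z)%fset J u x
            + mulv_off A J (fun y => v y + c) x)
  (xi1 : norm_on Kt (invG_xi J K A z) < 1).

(** [xi] is the reduction of the exit probability [r] by elimination of [A']:
    from [x] it is the probability of leaving [A] before the next visit to
    [K]. *)
Lemma xiAp x : x \in Ap -> xi J K A x = mulv_on Ap N22 r x.
Proof.
move=> xA; rewrite /xi (negPf (Ap_notin_K xA)); apply/eqP.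
have -> : \sum_(y <- K) N22_R21 x y = mulv_on K N22_R21 (fun=> 1) x.
  by apply: eq_bigr => y _; rewrite mulr1.
rewrite subr_eq mulv_on_N22_R21 -mulv_onD eq_sym; apply/eqP.
have one y : 1 = r y + mulv_on K J (fun=> 1) y + mulv_on Ap J (fun=> 1) y.
  rewrite rE -addrA -mulv_on_A /mulv_on.
  by under [X in _ + X]eq_bigr do rewrite mulr1; rewrite subrK.
apply/eqP; rewrite eq_le; apply/andP; split.
  by apply: (inv_block_ge ApM0 Apg0 ApMg (w := fun=> 1)) => // y _; rewrite -one.
by apply: (inv_block_le ApM0 Apg0 ApMg (w := fun=> 1)) => // y _; rewrite -one.
Qed.

Lemma xiK x : x \in K -> xi J K A x = reduced r x.
Proof.
move=> xK; rewrite /xi xK /reduced big_split /=.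
rewrite (_ : \sum_(y <- K) R12_N22_R21 J K A x y =
             mulv_on Ap J (fun a => 1 - mulv_on Ap N22 r a) x); last first.
  rewrite /R12_N22_R21 /mulm_on exchange_big [LHS]big_seq [RHS]big_seq.
  apply: eq_bigr => a aA; rewrite -mulr_sumr -xiAp// /xi.
  by rewrite (negPf (Ap_notin_K aA)) subKr.
rewrite mulv_onB rE -[X in _ = 1 - X + _](_ : mulv_on A J (fun=> 1) x = _).
  rewrite mulv_on_A (_ : mulv_on K J (fun=> 1) x = \sum_(y <- K) J x y).
    lra.
  by apply: eq_bigr => y _; rewrite mulr1.
by apply: eq_bigr => y _; rewrite mulr1.
Qed.

Lemma xi_ge0 x : x \in (A `\ z)%fset -> 0 <= xi J K A x.
Proof.
move=> /Az_cases /orP[xK|xA].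
  rewrite xiK ?in_Kt// addr_ge0//; apply: mulv_on_ge0 => // a aA.
  by apply: mulv_on_ge0 => // b _; exact: N22_ge0.
by rewrite xiAp//; apply: mulv_on_ge0 => // b _; exact: N22_ge0.
Qed.

Let c := norm_on Kt u.

Let c0 : 0 <= c. Proof. exact: norm_on_ge0. Qed.

Let uc y : y \in Kt -> u y <= c.
Proof. by move=> /(norm_on_ge u); apply: le_trans; exact: ler_norm. Qed.

Let f x := q x + mulv_off A J v x + r x * c.

Let huf x : x \in (A `\ z)%fset -> u x <= f x + mulv_on (A `\ z)%fset J u x.
Proof.
rewrite in_fsetD1 => /andP[_ xA]; have := hu c0 uc xA.
by rewrite offE// /f; lra.
Qed.

Let N22f x : mulv_on Ap N22 f x =
  mulv_on Ap N22 q x + mulv_on Ap N22 (mulv_off A J v) x + mulv_on Ap N22 r x * c.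
Proof. by rewrite /f !mulv_onD mulv_onZ. Qed.

Let reducedf x : x \in K ->
  reduced f x = betaq J K A q v x + xi J K A x * c.
Proof.
move=> xK; rewrite /betaq kqK// /ktq xK xiK// /reduced.
rewrite (eq_mulv_on J (g := fun x => mulv_on Ap N22 q x
  + mulv_on Ap N22 (mulv_off A J v) x + mulv_on Ap N22 r x * c)); last first.
  by move=> a _; exact: N22f.
rewrite !mulv_onD mulv_onZ /f; ring.
Qed.

Lemma upper_Kt_pre x : x \in Kt ->
  u x <= invG_beta J K A z q v x + invG_xi J K A z x * c.
Proof.
have [_ hK] := eliminate_le huf.
rewrite -mulv_onZ -mulv_onD.
apply: (inv_block_le KtM0 Ktg0 KtMg) => y yK.
by rewrite -reducedf ?in_Kt// hK.
Qed.

(** The maximum of [u] over [K - {z}] solves a scalar linear inequality. *)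
Lemma norm_u_le : c <= norm_on Kt (invG_beta J K A z q v) /
                  (1 - norm_on Kt (invG_xi J K A z)).
Proof.
rewrite ler_pdivlMr ?subr_gt0//.
suff : c <= norm_on Kt (invG_beta J K A z q v) + norm_on Kt (invG_xi J K A z) * c.
  lra.
apply: norm_on_le => [|x xK]; first by rewrite addr_ge0 ?mulr_ge0 ?norm_on_ge0.
rewrite ger0_norm//; apply: le_trans (upper_Kt_pre xK) _; apply: lerD.
  by apply: le_trans (ler_norm _) _; exact: norm_on_ge.
rewrite ler_wpM2r//.
by apply: le_trans (ler_norm _) _; exact: norm_on_ge.
Qed.

Lemma upper_Kt_ge x : x \in Kt -> u x <= upper_Kt J K A z q v x.
Proof.
move=> xK; apply: le_trans (upper_Kt_pre xK) _; rewrite lerD2l.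
rewrite ler_wpM2l ?norm_u_le//; apply: mulv_on_ge0 => [a _|a /Kt_Az].
  exact: invG_ge0.
exact: xi_ge0.
Qed.

Let c_upper : c <= norm_on Kt (upper_Kt J K A z q v).
Proof.
apply: norm_on_le => [|x xK]; first exact: norm_on_ge0.
rewrite ger0_norm//; apply: le_trans (upper_Kt_ge xK) _.
by apply: le_trans (ler_norm _) _; exact: norm_on_ge.
Qed.

Lemma upper_Az_ge x : x \in (A `\ z)%fset -> u x <= upper_Az J K A z q v x.
Proof.
move=> xAz; rewrite /upper_Az; case: ifP => xK.
  by apply: upper_Kt_ge; move: xAz; rewrite !in_fsetD1 xK => /andP[->].
move: (Az_cases xAz) => /orP[/in_Kt|xA]; first by rewrite xK.
have [hA _] := eliminate_le huf; apply: le_trans (hA x xA) _.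
rewrite N22f -xiAp// /betaq kqAp// /ktq xK -[leRHS]addrA.
rewrite -!addrA !lerD2l addrC lerD//.
  by apply: mulv_on_le => [a _|a]; [exact: N22_R21_ge0|exact: upper_Kt_ge].
by rewrite ler_wpM2l// xi_ge0.
Qed.

Lemma upper_kappa_ge x : x \in A -> u x <= upper_kappa J K A z q v x.
Proof.
move=> xA; rewrite /upper_kappa; case: eqVneq xA => [-> zA|xz xA].
  apply: le_trans (hu c0 uc zA) _; rewrite !offE ?norm_on_ge0//.
  have : mulv_on (A `\ z)%fset J u z
         <= mulv_on (A `\ z)%fset J (upper_Az J K A z q v) z.
    by apply: mulv_on_le => //; exact: upper_Az_ge.
  have : r z * c <= r z * norm_on Kt (upper_Kt J K A z q v).
    by rewrite ler_wpM2l.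
  lra.
by apply: upper_Az_ge; rewrite in_fsetD1 xz.
Qed.

End Upper.

End Truncation.

(** * Bounds for the potential of a forcing function *)

Section Potential.
Local Open Scope ereal_scope.
Context {R : realType} {S : countType} (J : S -> S -> R) (z : S).
Context (J0 : forall x y, (0 <= J x y)%R)
  (J1 : forall x, \esum_(y in setT) (J x y)%:E = 1)
  (Jirr : forall x y, exists n, 0 < iter n (act J setT) (ind y) x).
Local Notation T := (act J (~` [set z])).
Local Notation pot q := (green J (~` [set z]) (fun w => (q w)%:E)).

(** The real value of the potential, when it is finite. *)
Definition potential (q : S -> R) (x : S) : R := fine (pot q x).

Section Finite.
Context (q : S -> R) (q0 : forall x, (0 <= q x)%R)
  (qfin : forall x, pot q x < +oo).

Lemma potentialE x : pot q x = (potential q x)%:E.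
Proof.
by rewrite fineK// ge0_fin_numE// green_ge0// => y; rewrite lee_fin.
Qed.

Lemma potential_ge0 x : (0 <= potential q x)%R.
Proof. by apply: fine_ge0; apply: green_ge0 => // y; rewrite lee_fin. Qed.

Lemma potential_fix x : (potential q x)%:E =
  (q x)%:E + \esum_(y in ~` [set z]) (J x y * potential q y)%:E.
Proof.
rewrite -potentialE green_fix//; congr (_ + _); apply: eq_esum => y _.
by rewrite potentialE EFinM.
Qed.

Lemma potential_ge (x : S) : (q x <= potential q x)%R.
Proof.
rewrite -lee_fin potential_fix leeDl//; apply: esum_ge0 => y _.
by rewrite lee_fin mulr_ge0// potential_ge0.
Qed.

Lemma potential_super (B : {fset S}) x : z \notin B ->
  (q x + mulv_on B J (potential q) x <= potential q x)%R.
Proof.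
move=> zB; rewrite -lee_fin EFinD [leRHS]potential_fix leeD2l//.
have J0u y : (0 <= J x y * potential q y)%R by rewrite mulr_ge0// potential_ge0.
rewrite /mulv_on -(esum_seq_fset (fun y _ => J0u y)).
rewrite [leRHS](esumID [set` B]); last by move=> y _; rewrite lee_fin.
rewrite [X in _ <= X + _](_ : _ = \esum_(y in [set` B]) (J x y * potential q y)%:E).
  by rewrite leeDl//; apply: esum_ge0 => y _; rewrite lee_fin.
congr esum; apply/seteqP; split=> [y []//|y /= yB]; split=> //= yz.
by move: zB; rewrite -yz yB.
Qed.

End Finite.

Context (K A : {fset S}) (zK : z \in K) (KA : (K `<=` A)%fset).

Let zA : z \in A. Proof. exact: (fsubsetP KA). Qed.

Let zAz : z \notin (A `\ z)%fset. Proof. by rewrite in_fsetD1 eqxx. Qed.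

(** The mean number of visits to [A - {z}] before [z]: a strict supersolution on
    [A - {z}]. *)
Definition visits (x : S) : R := potential (fun w => (w \in (A `\ z)%fset)%:R) x.

Let v0 (x : S) : (0 <= (x \in (A `\ z)%fset)%:R :> R)%R. Proof. by []. Qed.

Let vfin x : pot (fun w => (w \in (A `\ z)%fset)%:R) x < +oo.
Proof.
have [C [_ hC]] := green_seq_bounded z J0 J1 Jirr (A `\ z)%fset.
exact: le_lt_trans (hC x) (ltry _).
Qed.

Lemma visits_ge1 x : x \in (A `\ z)%fset -> (1 <= visits x)%R.
Proof. by move=> xA; have := potential_ge v0 vfin x; rewrite xA. Qed.

Lemma visits_super x : x \in (A `\ z)%fset ->
  (1 + mulv_on (A `\ z)%fset J visits x <= visits x)%R.
Proof. by move=> xA; have := potential_super v0 vfin x zAz; rewrite xA. Qed.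

Context (q v : S -> R) (c : R) (q0 : forall x, (0 <= q x)%R)
  (vge0 : forall x, (0 <= v x)%R) (drift : drift_inequality J K q v c).

Lemma drift_finite x : pot q x < +oo.
Proof. exact: (green_drift_finite z J0 J1 Jirr q0 vge0 drift). Qed.

Local Notation u := (potential q).

Let u0 x : (0 <= u x)%R. Proof. exact: potential_ge0. Qed.

Let uE x : pot q x = (u x)%:E. Proof. exact: (potentialE q0 drift_finite). Qed.

(** Off [K], the potential exceeds the Lyapunov function by at most the maximum
    of the potential over [K - {z}]. *)
Lemma potential_le_off (b : R) x : (0 <= b)%R ->
  (forall y, y \in Ktilde K z -> (u y <= b)%R) -> x \notin K ->
  (u x <= v x + b)%R.
Proof.
move=> b0 ub xK.
(* [f] is a supersolution of [q + T f <= f], by the drift inequality off [K]. *)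
pose f y := if y \in K then u y else Num.min (u y) (v y + b)%R.
have f0 y : (0 <= f y)%R.
  by rewrite /f; case: ifP => // _; rewrite le_min u0 addr_ge0.
have fu y : (f y <= u y)%R.
  by rewrite /f; case: ifP => // _; rewrite ge_min lexx.
have fv y : y != z -> (f y <= v y + b)%R.
  move=> yz; rewrite /f; case: ifP => yK; last by rewrite ge_min lexx orbT.
  by apply: le_trans (ub y _) _; rewrite ?in_fsetD1 ?yz// lerDr.
suff h : (u x)%:E <= (f x)%:E.
  move: h; rewrite lee_fin /f (negPf xK) => /le_trans; apply.
  by rewrite ge_min lexx orbT.
rewrite -uE; apply: (@green_min _ _ _ _ J0 _ (fun y => (f y)%:E)).
- by move=> y; rewrite lee_fin.
- by move=> y; rewrite lee_fin.
move=> y.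
have le_u : (q y)%:E + T (fun w => (f w)%:E) y <= (u y)%:E.
  rewrite -uE green_fix//.
  by rewrite leeD2l//; apply: le_act => // w _; rewrite uE lee_fin.
rewrite {2}/f; case: ifPn => // yK.
rewrite EFin_min le_min le_u /=.
apply: (@le_trans _ _ ((q y)%:E + (T (fun w => (v w)%:E) y + T (cst b%:E) y))).
  rewrite leeD2l// -actD//; apply: le_act => // w /= /eqP wz.
  by rewrite -EFinD lee_fin fv.
apply: (@le_trans _ _ ((q y)%:E + ((v y - q y)%:E + b%:E))).
  rewrite leeD2l//; apply: leeD; last exact: act_cst_le.
  apply: le_trans (act_le_actT z J0 y _) _; first by move=> w; rewrite lee_fin.
  have := drift y; rewrite (negPf yK) mulr0 addr0; apply: le_trans.
  by apply: le_esum => w _; rewrite EFinM.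
by rewrite -!EFinD lee_fin; lra.
Qed.

Let exitp (x : S) : R := (1 - \sum_(y <- A) J x y)%R.

Let exitE x : \esum_(y in ~` [set` A]) (J x y)%:E = (exitp x)%:E.
Proof.
have := J1 x; rewrite (esumID [set` A])//; last by move=> y _; rewrite lee_fin.
rewrite !setTI esum_seq_fset// => h.
by rewrite /exitp EFinB -h [X in X - _]addeC addeK.
Qed.

Let exit_ge0 x : (0 <= exitp x)%R.
Proof. by rewrite -lee_fin -exitE; apply: esum_ge0 => y _; rewrite lee_fin. Qed.

Let offv x : \esum_(y in ~` [set` A]) (J x y * v y)%:E = (mulv_off A J v x)%:E.
Proof.
rewrite fineK// ge0_fin_numE; last first.
  by apply: esum_ge0 => y _; rewrite lee_fin mulr_ge0.
have := drift x; rewrite (esumID [set` A]); last first.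
  by move=> y _; rewrite lee_fin mulr_ge0.
rewrite !setTI => h; apply: (le_lt_trans (le_trans _ h) (ltry _)).
rewrite leeDr//; apply: esum_ge0 => y _.
by rewrite lee_fin mulr_ge0.
Qed.

Let offvb b x : (0 <= b)%R ->
  \esum_(y in ~` [set` A]) (J x y * (v y + b))%:E =
  (mulv_off A J v x + exitp x * b)%:E.
Proof.
move=> b0; rewrite EFinD -offv mulrC EFinM -exitE -esumZ//; last first.
  by move=> y _; rewrite lee_fin.
rewrite -esumD.
- by apply: eq_esum => y _; rewrite -EFinM -EFinD mulrDr (mulrC b).
- by move=> y _; rewrite lee_fin mulr_ge0.
- by move=> y _; rewrite lee_fin mulr_ge0.
Qed.

Let offE b x : (0 <= b)%R ->
  mulv_off A J (fun y => v y + b)%R x = (mulv_off A J v x + exitp x * b)%R.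
Proof. by move=> b0; rewrite [LHS]/mulv_off offvb. Qed.

Let u_super x : x \in A -> (q x + mulv_on (A `\ z)%fset J u x <= u x)%R.
Proof. by move=> _; exact: (potential_super q0 drift_finite x zAz). Qed.

Let u_sub b x : (0 <= b)%R ->
  (forall y, y \in Ktilde K z -> (u y <= b)%R) -> x \in A ->
  (u x <= q x + mulv_on (A `\ z)%fset J u x
          + mulv_off A J (fun y => v y + b) x)%R.
Proof.
move=> b0 ub _; have Ju y : (0 <= J x y * u y)%R by rewrite mulr_ge0.
rewrite -lee_fin (potential_fix q0 drift_finite) !EFinD -addeA leeD2l//.
rewrite offE// -offvb// /mulv_on -(esum_seq_fset (fun y _ => Ju y)).
rewrite [leLHS](esumID [set` A]); last by move=> y _; rewrite lee_fin.
apply: leeD.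
  rewrite (_ : ~` [set z] `&` [set` A] = [set` (A `\ z)%fset])//.
  apply/seteqP; split=> y /=; rewrite in_fsetD1.
    by move=> [/eqP -> ->].
  by move=> /andP[/eqP yz yA].
rewrite (_ : ~` [set z] `&` ~` [set` A] = ~` [set` A]).
  apply: le_esum => y /= /negP yA; rewrite lee_fin ler_wpM2l//.
  apply: potential_le_off => //; apply: contraNN yA.
  exact: (fsubsetP KA).
apply/seteqP; split=> y /=; first by case.
by move=> yA; split=> // yz; apply: yA; rewrite yz.
Qed.

Lemma potential_lower x : x \in A -> (lower_kappa J K A z q x <= u x)%R.
Proof.
exact: (lower_kappa_le J0 zK KA visits_ge1 visits_super u_super).
Qed.

Lemma lower_kappa_nneg x : x \in A -> (0 <= lower_kappa J K A z q x)%R.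
Proof. exact: (lower_kappa_ge0 J0 zK KA visits_ge1 visits_super q0). Qed.

Lemma lower_kappa_at_z : (q z <= lower_kappa J K A z q z)%R.
Proof. exact: (lower_kappa_z_ge J0 zK KA visits_ge1 visits_super q0). Qed.

Lemma potential_upper x :
  (norm_on (Ktilde K z) (invG_xi J K A z) < 1)%R ->
  x \in A -> (u x <= upper_kappa J K A z q v x)%R.
Proof.
move=> xi1.
exact: (upper_kappa_ge J0 zK KA visits_ge1 visits_super u0 exit_ge0
  (fun=> erefl) offE u_sub xi1).
Qed.

End Potential.

(** * From the process to its jump matrix *)

Section JumpMatrix.
Context {R : realType} {S : countType} (Q : S -> S -> R).
Context (rateQ : rate_matrix Q).
Local Notation J := (jump_matrix Q).
Local Notation lam := (jump_rate Q).

Lemma jump_rate_gt0 x : 0 < lam x. Proof. by case: rateQ. Qed.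

Lemma jump_matrix_ge0 x y : 0 <= J x y.
Proof.
rewrite /jump_matrix; case: eqVneq => // xy; case: rateQ => Q0 _ _.
by rewrite divr_ge0 ?Q0// ltW// jump_rate_gt0.
Qed.

Lemma rate_matrixE x y : Q x y = lam x * J x y - lam x * (x == y)%:R.
Proof.
rewrite /jump_matrix; case: eqVneq => [<-|xy].
  by rewrite mulr0 sub0r mulr1 /jump_rate opprK.
by rewrite mulr0 subr0 mulrC divfK// gt_eqF// jump_rate_gt0.
Qed.

Lemma esum_diag (c : R) (x : S) : 0 <= c ->
  (\esum_(y in setT) (c * (x == y)%:R)%:E = c%:E)%E.
Proof.
move=> c0; rewrite [RHS](esum_ind (q := fun=> c) x (fun=> c0)).
by apply: eq_esum => y _; rewrite /ind -EFinM.
Qed.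

Lemma jump_matrix_sum x : (\esum_(y in setT) (J x y)%:E = 1)%E.
Proof.
have lam0 := ltW (jump_rate_gt0 x); case: rateQ => _ _ /(_ x) hs.
have := has_sum_esum hs (rate_matrixE x)
  (fun y => mulr_ge0 lam0 (jump_matrix_ge0 x y))
  (fun y => mulr_ge0 lam0 (ler0n _ (x == y))) (esum_diag x lam0).
rewrite add0r; under eq_esum do rewrite EFinM.
rewrite esumZ//; last by move=> y _; rewrite lee_fin jump_matrix_ge0.
move=> /(congr1 (fun t => (lam x)^-1%:E * t)%E).
by rewrite muleA -EFinM mulVf ?gt_eqF ?jump_rate_gt0// mul1e.
Qed.

(** [eta lam] is stationary for the jump matrix when [eta] is invariant. *)
Lemma jump_stationary eta : invariant_measure Q eta ->
  stationary J (fun x => eta x * lam x).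
Proof.
move=> [eta0 _ inv]; split=> [x|y]; first by rewrite mulr_ge0// ltW// jump_rate_gt0.
have lam0 x := ltW (jump_rate_gt0 x).
have e0 : 0 <= eta y * lam y by rewrite mulr_ge0.
have fE x : eta x * Q x y =
    eta x * lam x * J x y - eta y * lam y * (y == x)%:R.
  rewrite rate_matrixE mulrBr -!mulrA; congr (_ - _); rewrite eq_sym.
  by case: eqVneq => [->//|_]; rewrite !mulr0.
have := has_sum_esum (inv y) fE
  (fun x => mulr_ge0 (mulr_ge0 (eta0 x) (lam0 x)) (jump_matrix_ge0 x y))
  (fun x => mulr_ge0 e0 (ler0n _ (y == x))) (esum_diag y e0).
by rewrite add0r.
Qed.

End JumpMatrix.

Section Process.
Local Open Scope ereal_scope.
Context {R : realType} {S : countType} {d : measure_display}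
  {Omega : measurableType d} (Q : S -> S -> R) (P : S -> probability Omega R)
  (Y : nat -> Omega -> S) (W : nat -> Omega -> R) (X : R -> Omega -> S).
Context (rateQ : rate_matrix Q) (mjp : markov_jump_process Q P Y W X).
Local Notation J := (jump_matrix Q).

Let J0 := jump_matrix_ge0 rateQ.

Let mY n x : measurable (Y n @^-1` [set x]). Proof. by case: mjp. Qed.

Let W0 n w : (0 < W n w)%R. Proof. by case: mjp. Qed.

(** The law of the jump chain, from the joint law with the holding times. *)
Lemma skeleton_law x n (y : nat -> S) :
  P x [set w | forall i, (i <= n)%N -> Y i w = y i] =
  ((y 0%N == x)%:R * \prod_(i < n) J (y i) (y i.+1))%:E.
Proof.
have [_ _ _ law _] := mjp.
have := law x n y (fun=> 0%R) (fun=> lexx _).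
under [X in _ = (_ * X)%:E -> _]eq_bigr do rewrite mulr0 oppr0 expR0.
rewrite big1_eq mulr1 => <-; congr (P x _); apply/seteqP.
by split=> w /= h i ik; [split; [exact: h|exact: W0]|case: (h i ik)].
Qed.

Lemma skeleton_irreducible : irreducible P Y ->
  forall x y, exists n, 0 < iter n (act J setT) (ind y) x.
Proof.
move=> irr x y; have [n hn] := irr x y; exists n; move: hn.
have <- : iter n (act J setT) (fun a => (a \in [set y])%:R%:E) x =
          iter n (act J setT) (ind y) x.
  by congr (iter n _ _ x); apply/funext => a; rewrite /ind in_set1.
rewrite -(path_law0 J0 mY skeleton_law).
by congr (0 < P x _); apply/seteqP; split=> w //= [].
Qed.

Context (z : S).

(** The hitting time exceeds [j] when [z] is not visited at the times
    [1, ..., j]. *)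
Lemma hitting_timeE j w :
  (j%:R%:E < hitting_time Y z w :> \bar R)%E <->
  (forall i, (0 < i <= j)%N -> Y i w <> z).
Proof.
split=> [jlt i /andP[i0 ij] Yi|h].
  move: jlt; rewrite ltNge => /negP; apply.
  apply: (@le_trans _ _ (i%:R%:E)); last by rewrite lee_fin ler_nat.
  by apply: ereal_inf_lbound; exists i.
apply: (@lt_le_trans _ _ (j.+1%:R%:E)); first by rewrite lte_fin ltr_nat.
apply: le_ereal_inf_tmp => _ [n [n0 Yn] <-]; rewrite lee_fin ler_nat.
rewrite ltnNge; apply/negP => nj; apply: (h n) => //.
by rewrite n0.
Qed.

(** The mean sum over a cycle is a potential of the jump matrix. *)
Lemma cycle_mean_green (f : S -> R) x : (forall y, (0 <= f y)%R) ->
  cycle_mean P Y z f x = green J (~` [set z]) (fun w => (f w)%:E) x.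
Proof.
move=> f0.
pose E j y : set Omega :=
  [set w | (forall i, (0 < i <= j)%N -> (~` [set z]) (Y i w)) /\ [set y] (Y j w)].
have mE j y : measurable (E j y) by exact: (measurable_path0 mY).
have PE j y : P x (E j y) = iter j (act J (~` [set z])) (ind y) x.
  rewrite (path_law0 J0 mY skeleton_law); congr (iter j _ _ x).
  by apply/funext => a; rewrite /ind in_set1.
pose F j n (w : Omega) : \bar R :=
  oapp (fun y => (f y)%:E * (\1_(E j y) w)%:E) 0 (pickle_inv n).
have F0 j n w : 0 <= F j n w.
  by rewrite /F; case: pickle_inv => //= y; rewrite -EFinM lee_fin mulr_ge0.
have mF j n : measurable_fun [set: Omega] (F j n).
  rewrite /F; case: pickle_inv => /= [y|]; last exact: measurable_cst.
  apply: measurable_funeM; apply/measurable_EFinP; exact: measurable_indic.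
have integrandE w :
    \sum_(0 <= j <oo | (j%:R%:E < hitting_time Y z w :> \bar R)%E) (f (Y j w))%:E =
    \sum_(j <oo) \sum_(n <oo) F j n w.
  rewrite eseries_mkcond; apply: eq_eseriesr => j _.
  rewrite -(esum_nneseries (a := fun y => (f y)%:E * (\1_(E j y) w)%:E));
    last by move=> y; rewrite -EFinM lee_fin mulr_ge0.
  case: ifPn => [/hitting_timeE h|/negP h].
    rewrite (esum_ind (Y j w) f0); apply: eq_esum => y _; congr (_ * _).
    rewrite /ind indicE (_ : (Y j w == y) = (w \in E j y))//.
    apply/eqP/idP => [yE|]; first by rewrite inE; split.
    by rewrite inE => -[].
  rewrite esum1// => y _; rewrite indicE memNset ?mule0// => -[hE _].
  by apply: h; apply/hitting_timeE => i ij; exact: hE.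
rewrite /cycle_mean (eq_integral _ _ (fun w _ => integrandE w)).
rewrite integral_nneseries//; first last.
- by move=> j w _; exact: nneseries_ge0.
- by move=> j; apply: ge0_emeasurable_sum.
rewrite /green -nneseries_esumT; last first.
  by move=> n; apply: iter_act_ge0 => // w; rewrite lee_fin.
apply: eq_eseriesr => j _; rewrite integral_nneseries//.
rewrite iter_act_ind// esum_nneseries; last first.
  move=> y; rewrite mule_ge0 ?lee_fin//; apply: iter_act_ge0 => // w.
  exact: ind_ge0.
apply: eq_eseriesr => n _; rewrite /F; case: pickle_inv => /= [y|]; last first.
  by rewrite integral0.
rewrite ge0_integralZl_EFin//.
  by rewrite integral_indic// setIT; congr (_ * _); exact: PE.
by apply/measurable_EFinP; exact: measurable_indic.
Qed.

Context (nonexp : non_explosive P W) (posrec : positive_recurrent P W X).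

Lemma jump_epochS n w : jump_epoch W n.+1 w = (jump_epoch W n w + W n w)%R.
Proof. by rewrite /jump_epoch big_ord_recr. Qed.

(** If the jump epochs tend to infinity, a return of [X] is one of [Y]. *)
Lemma return_skeleton w : (\sum_(n <oo) (W n w)%:E = +oo)%E ->
  return_time W X z w < +oo -> exists n, (0 < n)%N /\ Y n w = z.
Proof.
move=> Woo ret; have [_ _ _ _ XY] := mjp.
have [t [Wt Xt]] : exists t, (W 0%N w <= t)%R /\ X t w = z.
  apply: contrapT => /forallNP h; move: ret.
  rewrite /return_time (_ : [set t%:E | t in _] = set0) ?ereal_inf0 ?ltxx//.
  by apply/seteqP; split=> // _ [t ht <-]; exact: (h t ht).
have [n hn] : exists n, (t < jump_epoch W n w)%R.
  apply: contrapT => /forallNP h.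
  suff : (\sum_(n <oo) (W n w)%:E <= t%:E)%E by rewrite Woo.
  apply: lime_le; first by apply: is_cvg_nneseries => k _ _; rewrite lee_fin ltW.
  apply: nearW => n; rewrite big_mkord sumEFin lee_fin leNgt.
  by apply/negP; exact: h.
have exn : exists n, (t < jump_epoch W n w)%R by exists n.
case: (ex_minnP exn) => -[|m] hm mmin.
  move: hm; rewrite /jump_epoch big_ord0 ltNge.
  by rewrite (le_trans _ Wt)// ltW.
have tm : (jump_epoch W m w <= t)%R.
  by rewrite leNgt; apply/negP => /mmin; rewrite ltnn.
exists m; split; last by rewrite -(XY w m t) ?tm.
case: m hm tm {mmin} => //; rewrite jump_epochS /jump_epoch big_ord0 add0r.
by rewrite ltNge Wt.
Qed.

(** The jump chain started at [z] returns to [z] almost surely. *)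
Lemma avoid_vanish (e : R) : (0 < e)%R ->
  exists n, iter n (act J (~` [set z])) (cst 1) z < e%:E.
Proof.
move=> e0.
pose E n : set Omega :=
  [set w | (forall i, (0 < i <= n)%N -> (~` [set z]) (Y i w)) /\ setT (Y n w)].
have mE n : measurable (E n) by exact: (measurable_path0 mY).
have PE n : P z (E n) = iter n (act J (~` [set z])) (cst 1) z.
  rewrite (path_law0 J0 mY skeleton_law); congr (iter n _ _ z).
  by apply/funext => a; rewrite in_setT.
have mcap : measurable (\bigcap_n E n) by exact: bigcap_measurable.
have cap0 : P z (\bigcap_n E n) = 0.
  apply/(negligibleP (P z) mcap).
  have [ret _] := posrec z.
  apply: negligibleS (negligibleU (nonexp z) ret) => w capw.
  apply: contrapT => /not_orP[/contrapT Woo /contrapT rw].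
  have [n [n0 Yn]] := return_skeleton Woo rw.
  by have [/(_ n) + _] := capw n I; apply; rewrite ?n0 ?leqnn.
have cvgE : P z \o E @ \oo --> P z (\bigcap_n E n).
  apply: nonincreasing_cvg_mu => //.
    by rewrite (le_lt_trans (probability_le1 _ _))// ltry.
  move=> m n mn; apply/subsetPset => w [h _]; split=> // i /andP[i0 im].
  by apply: h; rewrite i0 (leq_trans im mn).
apply: contrapT => /forallNP h.
have : e%:E <= P z (\bigcap_n E n).
  rewrite -(cvg_lim _ cvgE)//; apply: lime_ge.
    by apply/cvg_ex; eexists; exact: cvgE.
  by apply: nearW => n /=; rewrite PE leNgt; apply/negP; exact: h.
by rewrite cap0 lee_fin leNgt e0.
Qed.

End Process.

(** * Poisson's equation and the bounds *)

Section Poisson.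
Context {R : realType} {S : countType} (Q : S -> S -> R) (rateQ : rate_matrix Q).
Context (z : S).
Local Notation J := (jump_matrix Q).
Local Notation lam := (jump_rate Q).
Local Notation u := (potential J z).

Let J0 := jump_matrix_ge0 rateQ.

Lemma potential_row (q : S -> R) x : (forall y, 0 <= q y) ->
  (forall y, (green J (~` [set z]) (fun w => (q w)%:E) y < +oo)%E) ->
  (\esum_(y in setT) (J x y * ((y != z)%:R * u q y))%:E = (u q x - q x)%:E)%E.
Proof.
move=> q0 qfin; rewrite EFinB (potential_fix J0 q0 qfin) [X in (X - _)%E]addeC addeK//.
rewrite [RHS]esum_mkcond; apply: eq_esum => y _.
rewrite in_setC in_set1; case: eqVneq => [_|_] /=; first by rewrite mul0r mulr0.
by rewrite mul1r.
Qed.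

(** A difference of two potentials [u_f - delta u_g] that vanishes at [z] solves
    Poisson's equation: the first step of the chain gives
    [J h = h - (f - delta g)]. *)
Lemma poisson_potential (f g : S -> R) (delta : R) (hs : S -> R) :
  (forall x, 0 <= f x) -> (forall x, 0 <= g x) -> 0 <= delta ->
  (forall y, (green J (~` [set z]) (fun w => (f w)%:E) y < +oo)%E) ->
  (forall y, (green J (~` [set z]) (fun w => (g w)%:E) y < +oo)%E) ->
  u f z = delta * u g z ->
  (forall x, hs x = (x != z)%:R * (u f x - delta * u g x)) ->
  poisson_solution Q (fun x => lam x * (f x - delta * g x)) hs.
Proof.
move=> f0 g0 d0 ffin gfin uz hsE x.
have lam0 : 0 <= lam x by rewrite ltW// jump_rate_gt0.
have uf0 y : 0 <= u f y by exact: potential_ge0.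
have ug0 y : 0 <= u g y by exact: potential_ge0.
pose a := (x != z)%:R * u f x; pose b := (x != z)%:R * (delta * u g x).
have a0 : 0 <= a by rewrite mulr_ge0.
have b0 : 0 <= b by rewrite !mulr_ge0.
pose G y := lam x * (J x y * ((y != z)%:R * u f y)) + lam x * b * (x == y)%:R.
pose H y := lam x * delta * (J x y * ((y != z)%:R * u g y))
            + lam x * a * (x == y)%:R.
have row0 q y : (forall v, 0 <= u q v) -> 0 <= J x y * ((y != z)%:R * u q y).
  by move=> uq0; rewrite !mulr_ge0// J0.
have sumE (c e : R) q : 0 <= c -> 0 <= e -> (forall v, 0 <= q v) ->
    (forall y, (green J (~` [set z]) (fun w => (q w)%:E) y < +oo)%E) ->
    (\esum_(y in setT)
      (c * (J x y * ((y != z)%:R * u q y)) + e * (x == y)%:R)%:E =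
    (c * (u q x - q x) + e)%:E)%E.
  move=> c0 e0 q0 qfin.
  have uq0 v : 0 <= u q v by exact: potential_ge0.
  rewrite EFinD -(esum_diag x e0) EFinM -potential_row// -esumZ//; last first.
    by move=> y _; rewrite lee_fin row0.
  rewrite -esumD.
  - by apply: eq_esum => y _; rewrite -EFinM -EFinD.
  - by move=> y _; rewrite -EFinM lee_fin mulr_ge0// row0.
  - by move=> y _; rewrite lee_fin mulr_ge0.
have -> : - (lam x * (f x - delta * g x)) =
    (lam x * (u f x - f x) + lam x * b) -
    (lam x * delta * (u g x - g x) + lam x * a).
  rewrite /a /b; case: eqVneq => [->|_] /=; last by ring.
  rewrite uz; ring.
apply: (has_sumB (g := G) (h := H)).
- move=> y; rewrite hsE (rate_matrixE rateQ) /G /H /a /b.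
  case: (eqVneq x y) => [<-|_] /=; first by ring.
  ring.
- by move=> y; rewrite addr_ge0 ?mulr_ge0// row0.
- by move=> y; rewrite addr_ge0 ?mulr_ge0// row0.
- by apply: sumE => //; rewrite mulr_ge0.
- by apply: sumE => //; rewrite mulr_ge0.
Qed.

End Poisson.

Theorem mainTheorem4 (R : realType) (S : countType)
  (d : measure_display) (Omega : measurableType d)
  (Q : S -> S -> R) (P : S -> probability Omega R)
  (Y : nat -> Omega -> S) (W : nat -> Omega -> R) (X : R -> Omega -> S)
  (eta : S -> R) (K A : {fset S}) (z : S) (s : S -> R)
  (vs ve : S -> R) (cs ce : R) :
  let J := jump_matrix Q in
  let delta := steady_mean eta s in
  let s' := fun x => s x / jump_rate Q x in
  let e' := fun x => 1 / jump_rate Q x in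
  let hstar := poisson_hstar P Y z s' e' delta in
  rate_matrix Q ->
  markov_jump_process Q P Y W X ->
  irreducible P Y ->
  non_explosive P W ->
  positive_recurrent P W X ->
  invariant_measure Q eta ->
  z \in K ->
  (K `<=` A)%fset ->
  (forall x, 0 <= s x) ->
  (\esum_(x in setT) (eta x * s x)%:E < +oo)%E ->
  (forall x, 0 <= vs x) ->
  (forall x, 0 <= ve x) ->
  drift_inequality J K s' vs cs ->
  drift_inequality J K e' ve ce ->
  norm_on (Ktilde K z) (invG_xi J K A z) < 1 ->
  [/\ forall x, (cycle_mean P Y z s' x < +oo)%E /\
                (cycle_mean P Y z e' x < +oo)%E,
      poisson_solution Q (fun x => s x - delta) hstar
    & forall x, x \in (A `\ z)%fset ->
        lower_kappa J K A z s' x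
        - upper_kappa J K A z s' vs z / lower_kappa J K A z e' z
          * upper_kappa J K A z e' ve x
        <= hstar x
        <= upper_kappa J K A z s' vs x
           - lower_kappa J K A z s' z / upper_kappa J K A z e' ve z
             * lower_kappa J K A z e' x].
Proof.
move=> J delta s' e' hstar rateQ mjp irr nonexp posrec inv zK KA s0 sfin vs0 ve0.
move=> drs dre xi1.
have lam0 x : 0 < jump_rate Q x by exact: jump_rate_gt0.
have J0 := jump_matrix_ge0 rateQ.
have J1 := jump_matrix_sum rateQ.
have Jirr := skeleton_irreducible rateQ mjp irr.
have s'0 x : 0 <= s' x by rewrite divr_ge0// ltW.
have e'0 x : 0 <= e' x by rewrite divr_ge0// ltW.
have sF := drift_finite z J0 J1 Jirr s'0 vs0 drs.
have eF := drift_finite z J0 J1 Jirr e'0 ve0 dre.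
have cmE := cycle_mean_green rateQ mjp z.
pose us := potential J z s'; pose ue := potential J z e'.
have us0 x : 0 <= us x by exact: potential_ge0.
have uez : 0 < ue z.
  by apply: lt_le_trans (potential_ge J0 e'0 eF z); rewrite divr_gt0.
pose mu x := eta x * jump_rate Q x.
have smu : stationary J mu := jump_stationary rateQ inv.
have muz : mu z != 0.
  apply/eqP => muz; case: inv => _ [x /eqP etax] _; apply: etax; apply/eqP.
  have /eqP := stationary_eq0 J0 Jirr smu muz x.
  by rewrite mulf_eq0 (gt_eqF (lam0 x)) orbF.
have rec := avoid_vanish rateQ mjp z nonexp posrec.
have cycle q : (forall x, 0 <= q x) ->
    (forall x, (green J (~` [set z]) (fun w => (q w)%:E) x < +oo)%E) ->
    (\esum_(x in setT) (mu x * q x)%:E = (mu z * potential J z q z)%:E)%E.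
  move=> q0 qF; rewrite (stationary_integral J0 J1 Jirr rec smu q0).
  by rewrite (potentialE J0 q0 qF).
(* The cycle formula for [s'] and [e'] gives [delta] as a ratio of potentials. *)
have deltaE : delta = us z / ue z.
  rewrite /delta /steady_mean.
  have -> : (\esum_(y in setT) (eta y * s y)%:E = (mu z * us z)%:E)%E.
    rewrite -cycle//; apply: eq_esum => x _; congr (_%:E).
    by rewrite /mu /s'; field; rewrite gt_eqF ?lam0.
  have -> : (\esum_(y in setT) (eta y)%:E = (mu z * ue z)%:E)%E.
    rewrite -cycle//; apply: eq_esum => x _; congr (_%:E).
    by rewrite /mu /e'; field; rewrite gt_eqF ?lam0.
  by rewrite /= -mulf_div divff// mul1r.
have delta0 : 0 <= delta by rewrite deltaE divr_ge0// ltW.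
have hstarE x : hstar x = (x != z)%:R * (us x - delta * ue x).
  rewrite /hstar /poisson_hstar; case: eqVneq => _; first by rewrite mul0r.
  by rewrite mul1r !cmE.
split.
- by move=> x; rewrite !cmE.
- have -> : (fun x => s x - delta) =
      (fun x => jump_rate Q x * (s' x - delta * e' x)).
    apply/funext => x; rewrite /s' /e'.
    by field; rewrite gt_eqF ?lam0.
  apply: (poisson_potential rateQ (z := z)) => //.
  by rewrite deltaE divfK// gt_eqF.
move=> x; rewrite in_fsetD1 => /andP[xz xA].
have zA : z \in A by exact: (fsubsetP KA).
rewrite hstarE xz mul1r.
have lsx := potential_lower J0 J1 Jirr zK KA s'0 vs0 drs xA.
have lsz := potential_lower J0 J1 Jirr zK KA s'0 vs0 drs zA.
have lex := potential_lower J0 J1 Jirr zK KA e'0 ve0 dre xA.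
have lez := potential_lower J0 J1 Jirr zK KA e'0 ve0 dre zA.
have Usx := potential_upper J0 J1 Jirr zK KA s'0 vs0 drs xi1 xA.
have Usz := potential_upper J0 J1 Jirr zK KA s'0 vs0 drs xi1 zA.
have Uex := potential_upper J0 J1 Jirr zK KA e'0 ve0 dre xi1 xA.
have Uez := potential_upper J0 J1 Jirr zK KA e'0 ve0 dre xi1 zA.
have lsz0 := lower_kappa_nneg J0 J1 Jirr zK KA s'0 zA.
have lex0 := lower_kappa_nneg J0 J1 Jirr zK KA e'0 xA.
have lez0 : 0 < lower_kappa J K A z e' z.
  apply: lt_le_trans (lower_kappa_at_z J0 J1 Jirr zK KA e'0).
  by rewrite divr_gt0.
have Uez0 := lt_le_trans uez Uez.
have ue0 : 0 <= ue x := le_trans lex0 lex.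
apply/andP; split; apply: lerB => //; rewrite deltaE.
  apply: ler_pM => //; first by rewrite divr_ge0// ltW.
  by apply: ler_pM; rewrite ?invr_ge0 ?(ltW uez)// lef_pV2 ?posrE.
apply: ler_pM => //; first by rewrite divr_ge0// ltW.
by apply: ler_pM; rewrite ?invr_ge0 ?(ltW Uez0)// lef_pV2 ?posrE.
Qed.
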